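(* Let $d\ge1$, let $W\subseteq\mathbb{R}^d$ be convex and compact, and for $t>0$ let $\eta_t$ be a Poisson point process on $W$ with intensity measure $t$ times Lebesgue measure restricted to $W$. Let $(\delta_t)_{t>0}$ be positive with $\delta_t\to0$ and $t\delta_t^d\to\infty$ as $t\to\infty$. For $\tau\in\mathbb{R}$ let $$L_t^{(\tau)}=\frac12\sum_{(x_1,x_2)\in\eta_{t,\neq}^2}\mathbf 1(\|x_1-x_2\|\le\delta_t)\|x_1-x_2\|^\tau,\qquad \tilde L_t^{(\tau)}=\frac{L_t^{(\tau)}-\mathbb{E}L_t^{(\tau)}}{\max\{t\delta_t^{\tau+d/2},\,t^{3/2}\delta_t^{\tau+d}\}},$$ where $\eta_{t,\neq}^2$ is the set of ordered pairs of distinct points of $\eta_t$. Let $\tau_1,\tau_2>-d/2$ and $a_i=\tau_i+d$. Then $$a_1\tilde L_t^{(\tau_1)}-a_2\tilde L_t^{(\tau_2)}\xrightarrow{\ \mathbb{P}\ }0\quad\text{as } t\to\infty.$$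
   Context: $L_t^{(\tau)}$ is the length power functional of the random geometric graph on the vertex set $\eta_t$ in which two distinct points are joined iff their Euclidean distance is at most $\delta_t$; the regime $t\delta_t^d\to\infty$ is the supercritical (dense) regime. Convergence is in probability. *)

(* Defs.v *)
From HB Require Import structures.
From mathcomp Require Import all_boot all_order all_algebra.
From mathcomp Require Import all_classical all_reals all_analysis.
Set Implicit Arguments. Unset Strict Implicit. Unset Printing Implicit Defensive.
Import Order.TTheory GRing.Theory Num.Theory.
Import numFieldNormedType.Exports.
Local Open Scope classical_set_scope.
Local Open Scope ring_scope.

(* Points of R^d are represented as d.-tuple R, which carries the product
   (= Borel) sigma-algebra generated by the coordinate projections. *)

Section Defs.
Variable R : realType.

(* d-dimensional Lebesgue measure, defined by iterated one-dimensional
   Lebesgue integrals of the indicator (Tonelli). *)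
Fixpoint lebesgue_d (n : nat) : set (n.-tuple R) -> \bar R :=
  match n return set (n.-tuple R) -> \bar R with
  | 0 => fun A => (if `[< A [tuple] >] then 1 else 0)%E
  | n'.+1 => fun A =>
      (\int[@lebesgue_measure R]_x lebesgue_d [set v | A (cons_tuple x v)])%E
  end.

Definition edist (d : nat) (x y : d.-tuple R) : R :=
  Num.sqrt (\sum_(i < d) (tnth x i - tnth y i) ^+ 2).

(* row-vector view of a point, used to transport the topology of 'rV[R]_d *)
Definition row_of_tuple (d : nat) (x : d.-tuple R) : 'rV[R]_d :=
  \row_i tnth x i.

Definition convex_set_d (d : nat) (W : set (d.-tuple R)) : Prop :=
  forall x y, W x -> W y -> forall l : R, 0 <= l <= 1 ->
    W [tuple (1 - l) * tnth x i + l * tnth y i | i < d].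

Definition compact_set_d (d : nat) (W : set (d.-tuple R)) : Prop :=
  compact (@row_of_tuple d @` W).

(* Poisson probability mass function, valid also for rate 0 *)
Definition poissonp (r : R) (k : nat) : R := r ^+ k / k`!%:R * expR (- r).

Definition npoints (d : nat) (s : seq (d.-tuple R)) (B : set (d.-tuple R)) : nat :=
  count (fun x => x \in B) s.

Definition is_poisson_pp (dO : measure_display) (O : measurableType dO)
    (P : probability O R) (d : nat) (X : O -> seq (d.-tuple R))
    (mu : set (d.-tuple R) -> R) : Prop :=
  (forall B, measurable B -> forall k : nat,
      measurable [set w | npoints (X w) B = k]) /\
  (forall (k : nat) (B : 'I_k -> set (d.-tuple R)) (n : 'I_k -> nat),
      (forall i, measurable (B i)) ->
      (forall i j, i != j -> B i `&` B j = set0) ->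
      P (\bigcap_(i in [set: 'I_k]) [set w | npoints (X w) (B i) = n i])
      = (\prod_(i < k) poissonp (mu (B i)) (n i))%:E).

Definition intensity (d : nat) (W : set (d.-tuple R)) (t : R) :=
  fun B : set (d.-tuple R) => t * fine (lebesgue_d (B `&` W)).

Definition length_power (d : nat) (delta tau : R) (s : seq (d.-tuple R)) : R :=
  2^-1 * \sum_(i < size s) \sum_(j < size s | i != j)
    (let r := edist (nth [tuple of nseq d 0] s i) (nth [tuple of nseq d 0] s j) in
     if r <= delta then r `^ tau else 0).

(* expectation (the functional is nonnegative) *)
Definition expect (dO : measure_display) (O : measurableType dO)
    (P : probability O R) (X : O -> R) : R :=
  fine (\int[P]_w (X w)%:E)%E.

Definition Ltilde (dO : measure_display) (O : measurableType dO)
    (P : probability O R) (d : nat) (eta : O -> seq (d.-tuple R))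
    (t delta tau : R) : O -> R :=
  fun w => (length_power delta tau (eta w)
            - expect P (fun w' => length_power delta tau (eta w')))
           / Num.max (t * delta `^ (tau + d%:R / 2))
                     (t `^ (3 / 2) * delta `^ (tau + d%:R)).

End Defs.

(* Main.v *)
(* Write L = (1/2) sum of f(x_i, x_j) over ordered pairs of distinct points, with f a
   symmetric kernel. Mecke's equation for the counts of finitely many disjoint
   cells, extended by a pi-lambda argument, shows that the factorial moment
   measures of a Poisson process of intensity mu are the powers of mu, so that
     Var L = int (int f(x,y) mu(dy))^2 mu(dx) + (1/2) int int f^2 dmu^2.
   Apply this to the difference f = f_1 - f_2 of the two kernels, normalised as in
   the statement. The integral of |z|^tau over a ball of radius delta is
   kappa d delta^(tau+d) / (tau+d), hence both kernels have the same integral K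
   over the whole space, and int_W f_i(x,y) dy = K - B_i(x) where B_i(x) only sees
   points outside W at distance at most delta from x. Therefore the first
   term is at most K int (B_1 + B_2), which is of the order of the Lebesgue measure
   of a shrinking neighbourhood of W minus W and tends to 0 by compactness of W.
   The second term is O(1 / (t delta^d)). Chebyshev's inequality concludes. *)
Require Import Defs.
From HB Require Import structures.
From mathcomp Require Import all_boot all_order all_algebra.
From mathcomp Require Import all_classical all_reals all_analysis.
From mathcomp Require Import measurable_realfun.
From mathcomp Require Import ring lra.
Import Order.TTheory GRing.Theory Num.Theory.
Import numFieldNormedType.Exports.
Local Open Scope classical_set_scope.
Local Open Scope ring_scope.
Set Implicit Arguments. Unset Strict Implicit. Unset Printing Implicit Defensive.

(** Why the factors a_i: the normalisation is delta^tau times a quantity free of tau ([nrm0]), and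
    a_i cancels the 1/(tau+d) of the radial integral, so both kernels have the same integral K over
    the whole space. The condition tau > -d/2 enters as 2 tau + d > 0, the integrability of the
    squared kernel. Since f_1 - f_2 changes sign, moments are computed for products f_i f_j of
    nonnegative kernels, where Tonelli applies, and the variance of the difference is assembled from
    them. Such a product of two pair sums involves up to four distinct points, hence factorial
    moment measures up to order four. The radial integral is found without polar coordinates:
    dilating by q = exp(-h) splits the ball into a smaller ball and a thin shell on which r^tau is
    nearly 1, and comparing first orders in h gives its value. Compactness of W also yields its
    measurability: W is the intersection of decreasing sets V n of finite measure, built from
    finitely many boxes, and V n contains all points at distance less than 1/(n+1) from W. *)

Local Notation edist := Defs.edist.

(** * Products and integrals of nonnegative functions *)

(** True for infinite [x] too, because [fine] sends both infinities to 0. Expectations and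
    intensities can thus be rescaled without a finiteness proof. *)
Lemma fineZl (R : realType) (a : R) (x : \bar R) : 0 < a -> fine (a%:E * x)%E = a * fine x.
Proof.
move=> a0; case: x => [r| |]; first by [].
- by rewrite mulry gtr0_sg // mul1e /= mulr0.
- by rewrite mulrNy gtr0_sg // mul1e /= mulr0.
Qed.

Section SigmaFiniteProduct.
Context (R : realType) (d1 d2 : measure_display) (T1 : measurableType d1)
  (T2 : measurableType d2) (m1 : {sigma_finite_measure set T1 -> \bar R})
  (m2 : {sigma_finite_measure set T2 -> \bar R}).
Local Open Scope ereal_scope.

(* The library's product measure, with its sigma-finiteness registered so that
   products can be iterated. *)
Definition sfprod : set (T1 * T2) -> \bar R := m1 \x m2.

HB.instance Definition _ := Measure.on sfprod.

Lemma sfprod_sigma_finite : sigma_finite setT sfprod.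
Proof.
(* Both exhaustions are nondecreasing, so the diagonal products [F n] times [G n] already cover the
   product space. *)
have /sigma_finiteP[F [TF ndF Ff]] := sigma_finiteT m1.
have /sigma_finiteP[G [TG ndG Gf]] := sigma_finiteT m2.
exists (fun n => F n `*` G n); last first.
  move=> n; have [mF fF] := Ff n; have [mG fG] := Gf n.
  split; first exact: measurableX.
  by rewrite /sfprod product_measure1E // lte_mul_pinfty // ge0_fin_numE.
apply/seteqP; split => // -[x y] _.
have [i _ Fx] : (\bigcup_i F i) x by rewrite -TF.
have [j _ Gy] : (\bigcup_i G i) y by rewrite -TG.
exists (maxn i j) => //; split => /=.
- by move: x Fx; exact/subsetPset/ndF/leq_maxl.
- by move: y Gy; exact/subsetPset/ndG/leq_maxr.
Qed.

HB.instance Definition _ := Measure_isSigmaFinite.Build _ _ _ sfprod sfprod_sigma_finite.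

Lemma sfprodX A B : measurable A -> measurable B -> sfprod (A `*` B) = m1 A * m2 B.
Proof. exact: product_measure1E. Qed.

Lemma integral_sfprod (f : T1 * T2 -> \bar R) : measurable_fun setT f ->
  (forall u, 0 <= f u) ->
  \int[sfprod]_u f u = \int[m1]_x \int[m2]_y f (x, y).
Proof. by move=> mf f0; rewrite (fubini_tonelli1 f). Qed.

End SigmaFiniteProduct.

Section RealIntegrals.
Local Open Scope ereal_scope.
Context (R : realType) (d : measure_display) (V : measurableType d) (nu : {measure set V -> \bar R}).

Lemma integral_EFinD (a b : V -> R) :
  measurable_fun setT a -> measurable_fun setT b ->
  (forall v, (0 <= a v)%R) -> (forall v, (0 <= b v)%R) ->
  \int[nu]_v (a v + b v)%:E = \int[nu]_v (a v)%:E + \int[nu]_v (b v)%:E.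
Proof.
move=> ma mb a0 b0; rewrite -ge0_integralD //; try exact/measurable_EFinP.
- by move=> v _; rewrite lee_fin.
- by move=> v _; rewrite lee_fin.
Qed.

Lemma integral_EFinZ (c : R) (a : V -> R) : (0 <= c)%R ->
  measurable_fun setT a -> (forall v, (0 <= a v)%R) ->
  \int[nu]_v (c * a v)%:E = c%:E * \int[nu]_v (a v)%:E.
Proof.
move=> c0 ma a0; rewrite -ge0_integralZl //; first exact/measurable_EFinP.
by move=> v _; rewrite lee_fin.
Qed.

(* Only nonnegative functions are integrated, so no integrability is needed. *)
Lemma integral_sqrB (a b : V -> R) (p q r : R) :
  measurable_fun setT a -> measurable_fun setT b ->
  (forall v, (0 <= a v)%R) -> (forall v, (0 <= b v)%R) ->
  \int[nu]_v (a v * a v)%:E = p%:E -> \int[nu]_v (b v * b v)%:E = q%:E ->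
  \int[nu]_v (a v * b v)%:E = r%:E ->
  \int[nu]_v ((a v - b v) ^+ 2)%:E = (p + q - 2 * r)%R%:E.
Proof.
move=> ma mb a0 b0 P1 Q1 R1.
have mab : measurable_fun setT (fun v => a v * b v)%R by exact: measurable_funM.
have maa : measurable_fun setT (fun v => a v * a v)%R by exact: measurable_funM.
have mbb : measurable_fun setT (fun v => b v * b v)%R by exact: measurable_funM.
have msq : measurable_fun setT (fun v => (a v - b v) ^+ 2)%R.
  by apply: measurable_funX; exact: measurable_funB.
have ab0 v : (0 <= a v * b v)%R by rewrite mulr_ge0.
have e : \int[nu]_v ((a v - b v) ^+ 2)%:E + (2 * r)%R%:E = (p + q)%R%:E.
  rewrite (EFinM 2 r) (EFinD p q) -R1 -P1 -Q1 -integral_EFinZ // -!integral_EFinD //.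
  - by apply: eq_integral => v _; congr EFin; ring.
  - by move=> v; rewrite mulr_ge0.
  - by move=> v; rewrite mulr_ge0.
  - exact: measurable_funM.
  - by move=> v; rewrite sqr_ge0.
  - by move=> v; rewrite mulr_ge0.
by rewrite EFinB -e addeK.
Qed.

End RealIntegrals.

(** * Factorial moments of Poisson counts *)

Section CountableValued.
Context (dO : measure_display) (O : measurableType dO) (R : realType)
  (P : probability O R) (K : countType) (N : O -> K).
Hypothesis mN : forall k, measurable (N @^-1` [set k]).

Lemma measurable_countable_comp (d : measure_display) (U : measurableType d)
  (phi : K -> U) : measurable_fun setT (phi \o N).
Proof.
move=> _ B mB; rewrite setTI.
have -> : (phi \o N) @^-1` B =
    \bigcup_k (if pselect (B (phi k)) then N @^-1` [set k] else set0).
  apply/seteqP; split => w /=.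
    by move=> Bw; exists (N w) => //; case: pselect.
  by move=> [k _]; case: pselect => // Bk /= ->.
apply: countable_bigcupT_measurable; first exact: countableP.
move=> k; case: (pselect (B (phi k))) => h; [exact: mN|exact: measurable0].
Qed.

Lemma integral_countable_comp (phi : K -> \bar R) : (forall k, 0 <= phi k)%E ->
  (\int[P]_w phi (N w) = \esum_(k in setT) (phi k * P (N @^-1` [set k])))%E.
Proof.
move=> phi0.
(* Countable additivity of the integral is applied along nat, so the fibres of [N] are indexed
   through [pickle]; indices outside its image give empty fibres. *)
pose F (i : nat) := [set w | pickle (N w) = i].
have mF i : measurable (F i).
  have := measurable_countable_comp (fun k : K => pickle k : nat).
  by move=> /(_ measurableT [set i] Logic.I); rewrite setTI.
have TF : [set: O] = \bigcup_i F i.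
  by apply/seteqP; split => w // _; exists (pickle (N w)).
have tF : trivIset setT F by move=> i j _ _ [w [/= <- <-]].
have mphi : measurable_fun setT (phi \o N) by exact: measurable_countable_comp.
rewrite {1}TF ge0_integral_bigcup //; last first.
  by rewrite -TF.
rewrite nneseries_esumT; last by move=> i; apply: integral_ge0.
transitivity (\esum_(i in [set (pickle k : nat) | k in [set: K]])
   \int[P]_(w in F i) phi (N w))%E.
  rewrite [RHS]esum_mkcond; apply: eq_esum => i _.
  case: ifPn => // /negP iK.
  have -> : F i = set0.
    by apply/seteqP; split => w //= iw; apply: iK; rewrite inE; exists (N w).
  by rewrite integral_set0.
rewrite esum_image; last by move=> x y _ _ /(pcan_inj pickleK).
apply: eq_esum => k _.
have -> : F (pickle k) = N @^-1` [set k].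
  apply/seteqP; split => w; rewrite /F /=; first exact: (pcan_inj pickleK).
  by move=> ->.
rewrite -integral_cst //; by apply: eq_integral => w; rewrite inE /cst => <-.
Qed.

End CountableValued.

Section PoissonVector.
Context (dO : measure_display) (O : measurableType dO) (R : realType)
  (P : probability O R) (I : finType) (lam : I -> R)
  (N : O -> {ffun I -> nat}).
Hypothesis lam0 : forall i, 0 <= lam i.
Hypothesis mN : forall n, measurable (N @^-1` [set n]).
Hypothesis PN : forall n,
  P (N @^-1` [set n]) = (\prod_i poissonp (lam i) (n i))%:E.

(** The truncated subtraction leaves [n] unchanged when [n i = 0]; below, [decr i n] always comes
    with a factor [n i], which vanishes in that case. *)
Definition decr (i : I) (n : {ffun I -> nat}) : {ffun I -> nat} :=
  [ffun j => (n j - (i == j))%N].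
Definition incr (i : I) (n : {ffun I -> nat}) : {ffun I -> nat} :=
  [ffun j => (n j + (i == j))%N].

Lemma incrK i : cancel (incr i) (decr i).
Proof. by move=> n; apply/ffunP => j; rewrite !ffunE addnK. Qed.

Lemma decrK i (n : {ffun I -> nat}) : (0 < n i)%N -> incr i (decr i n) = n.
Proof.
move=> ni; apply/ffunP => j; rewrite !ffunE.
by case: eqVneq => [<-|_]; rewrite ?subnK // subn0 addn0.
Qed.

Lemma poissonpS (r : R) k : k.+1%:R * poissonp r k.+1 = r * poissonp r k.
Proof.
rewrite /poissonp factS natrM exprS invfM !mulrA; congr (_ * _).
rewrite -!mulrA (mulrCA k.+1%:R); congr (_ * _); rewrite mulrCA; congr (_ * _).
by rewrite mulrA mulfV ?mul1r // pnatr_eq0.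
Qed.

Lemma prod_poissonp_incr i (n : {ffun I -> nat}) :
  (n i).+1%:R * (\prod_j poissonp (lam j) (incr i n j)) =
  lam i * \prod_j poissonp (lam j) (n j).
Proof.
have E : incr i n i = (n i).+1 by rewrite ffunE eqxx addn1.
rewrite (bigD1 i) //= [in RHS](bigD1 i) //= E [LHS]mulrA [RHS]mulrA poissonpS.
congr (_ * _); apply: eq_bigr => j ji.
by rewrite ffunE eq_sym (negbTE ji) addn0.
Qed.

(** Only count vectors with [n i > 0] contribute, and these are the [incr i m]. Reindexing by [m]
    and using (k+1) p(k+1) = r p(k) for the Poisson weights moves the factor [lam i] out. *)
Lemma mecke_vector i (g : {ffun I -> nat} -> nat) :
  (\int[P]_w ((N w i)%:R * (g (decr i (N w)))%:R)%:E
   = (lam i)%:E * \int[P]_w ((g (N w))%:R)%:E)%E.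
Proof.
rewrite (integral_countable_comp P mN (phi := fun n => ((n i)%:R * (g (decr i n))%:R)%:E)); last first.
  by move=> n; rewrite lee_fin.
have mg : measurable_fun setT (fun w => ((g (N w))%:R)%:E : \bar R).
  exact: (measurable_countable_comp mN (fun n => ((g n)%:R)%:E : \bar R)).
rewrite -ge0_integralZl //; last by rewrite lee_fin.
rewrite (integral_countable_comp P mN (phi := fun n => ((lam i)%:E * (g n)%:R%:E)%E)); last first.
  by move=> n; rewrite -EFinM lee_fin mulr_ge0.
transitivity (\esum_(n in [set incr i m | m in setT])
  (((n i)%:R * (g (decr i n))%:R)%:E * P (N @^-1` [set n])))%E.
  rewrite [RHS]esum_mkcond; apply: eq_esum => n _.
  case: ifPn => // /negP iK.
  have -> : n i = 0%N.
    apply/eqP; rewrite eqn0Ngt; apply/negP => ni; apply: iK; rewrite inE.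
    by exists (decr i n) => //; exact: decrK.
  by rewrite mul0r mul0e.
rewrite esum_image; last by move=> x y _ _ /(can_inj (incrK i)).
apply: eq_esum => n _; rewrite incrK !PN -!EFinM; congr EFin.
by rewrite ffunE eqxx addn1 mulrAC prod_poissonp_incr mulrAC.
Qed.

(** The number of ways to draw points one after the other without replacement, the k-th from a cell
    satisfying the k-th predicate. When all predicates agree it is a falling factorial. *)
Fixpoint facpoly (l : seq (pred I)) (n : {ffun I -> nat}) : nat :=
  if l is A :: l' then (\sum_(i | A i) n i * facpoly l' (decr i n))%N else 1%N.

(** Each factor costs one use of Mecke's equation per cell. Since the drawn point is removed, no
    diagonal terms arise and the moment is a pure product. *)
Lemma integral_facpoly l :
  (\int[P]_w ((facpoly l (N w))%:R)%:E
   = (\prod_(A <- l) \sum_(i | A i) lam i)%:E)%E.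
Proof.
elim: l => [|A l IH] /=.
  by rewrite big_nil (integral_cst P measurableT) mul1e; exact: probability_setT.
rewrite big_cons.
transitivity (\int[P]_w (\sum_(i <- [seq i <- index_enum I | A i])
   ((N w i)%:R * (facpoly l (decr i (N w)))%:R)%:E)%E)%E.
  apply: eq_integral => w _; rewrite big_filter sumEFin natr_sum.
  by congr EFin; apply: eq_bigr => i _; rewrite natrM.
rewrite ge0_integral_sum //; last first.
  move=> i.
  exact: (measurable_countable_comp mN
     (fun n => ((n i)%:R * (facpoly l (decr i n))%:R)%:E : \bar R)).
rewrite (eq_bigr (fun i => (lam i * \prod_(A <- l) \sum_(i | A i) lam i)%:E)); last first.
  by move=> i _; rewrite EFinM -IH; exact: mecke_vector.
by rewrite big_filter sumEFin mulr_suml.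
Qed.

End PoissonVector.

(** The analogue of [facpoly] on the list of points itself. [rem] deletes a single occurrence, so
    repeated entries count as distinct points. *)
Fixpoint facsum (T : eqType) (l : seq (pred T)) (s : seq T) : nat :=
  if l is A :: l' then (\sum_(x <- s | A x) facsum l' (rem x s))%N else 1%N.

Lemma facsum_facpoly (T : eqType) (I : finType) (c : T -> I) (l : seq (pred I)) s :
  facsum [seq (A \o c : pred T) | A <- l] s
  = facpoly l [ffun i => count (fun x => c x == i) s].
Proof.
elim: l s => [//|A l IH] s /=.
rewrite (partition_big c A) //=; apply: eq_bigr => i Ai.
rewrite (eq_bigr (fun x => facsum [seq (A \o c : pred T) | A <- l] (rem x s))) //.
rewrite big_seq_cond.
rewrite (eq_bigr (fun _ => facpoly l (decr i [ffun i => count (fun x => c x == i) s]))); last first.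
  move=> x /and3P[xs _ /eqP cx]; rewrite IH; congr facpoly; apply/ffunP => j.
  by rewrite !ffunE count_rem xs /= cx.
rewrite -big_seq_cond big_const_seq iter_addn_0 mulnC ffunE; congr (_ * _)%N.
by apply: eq_count => x /=; case: eqP => [->|]; rewrite ?andbF ?Ai.
Qed.

Section PoissonProcess.
Context (dO : measure_display) (O : measurableType dO) (R : realType)
  (P : probability O R) (dT : measure_display) (T : measurableType dT)
  (mu : {measure set T -> \bar R}) (X : O -> seq T).
Hypothesis muT : (mu setT < +oo)%E.
Hypothesis mX : forall B, measurable B -> forall k : nat,
  measurable [set w | count (fun x => x \in B) (X w) = k].
Hypothesis PX : forall (k : nat) (B : 'I_k -> set T) (n : 'I_k -> nat),
  (forall i, measurable (B i)) ->
  (forall i j, i != j -> B i `&` B j = set0) ->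
  P (\bigcap_(i in [set: 'I_k]) [set w | count (fun x => x \in B i) (X w) = n i])
  = (\prod_(i < k) poissonp (fine (mu (B i))) (n i))%:E.

Lemma finite_mu A : measurable A -> mu A \is a fin_num.
Proof.
by move=> mA; rewrite ge0_fin_numE //; apply: le_lt_trans muT; apply: le_measure; rewrite ?inE.
Qed.

(** The Poisson law is given on disjoint families, whereas the sets of [l] may overlap or repeat.
    The cells [B i] are the atoms of the algebra they generate, indexed by the pattern of sets
    containing the point. *)
Lemma facsum_moment (l : seq (set T)) : (forall A, A \in l -> measurable A) ->
  measurable_fun setT
    (fun w => (facsum [seq (fun x => x \in A) | A <- l] (X w))%:R%:E : \bar R) /\
  (\int[P]_w (facsum [seq (fun x => x \in A) | A <- l] (X w))%:R%:E
   = (\prod_(A <- l) fine (mu A))%:E)%E.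
Proof.
move=> ml; pose k := size l; pose I := {ffun 'I_k -> bool}.
pose c (x : T) : I := [ffun j : 'I_k => x \in nth set0 l j].
pose B (i : I) := c @^-1` [set i].
have mlj (j : 'I_k) : measurable (nth set0 l j) by apply/ml/mem_nth.
have mB i : measurable (B i).
  have -> : B i = \bigcap_(j in [set: 'I_k])
      (if i j then nth set0 l j else ~` nth set0 l j).
    apply/seteqP; split => x /=.
      move=> <- j _; rewrite ffunE; case: ifPn; first by rewrite inE.
      by move=> /negP + xj; apply; rewrite inE.
    move=> h; apply/ffunP => j; rewrite ffunE; have := h j Logic.I.
    case: (i j) => xj; first exact: mem_set.
    by apply/negbTE; rewrite notin_setE.
  apply: fin_bigcap_measurable; first exact: finite_finset.
  by move=> j _; case: ifP => // _; exact: measurableC.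
pose lam i := fine (mu (B i)).
pose N w : {ffun I -> nat} := [ffun i => count (fun x => c x == i) (X w)].
have BE i x : (c x == i) = (x \in B i) by apply/eqP/idP; rewrite inE.
have NE n : N @^-1` [set n] = \bigcap_(i in [set: 'I_#|I|])
   [set w | count (fun x => x \in B (enum_val i)) (X w) = n (enum_val i)].
  apply/seteqP; split => w /=.
    by move=> <- i _ /=; rewrite ffunE; apply: eq_count => x; rewrite BE.
  move=> h; apply/ffunP => i; have := h (enum_rank i) Logic.I.
  rewrite /= enum_rankK ffunE => <-.
  by apply: eq_count => x; rewrite BE.
have mN n : measurable (N @^-1` [set n]).
  rewrite NE; apply: fin_bigcap_measurable; first exact: finite_finset.
  by move=> i _; exact: mX.
have PN n : P (N @^-1` [set n]) = (\prod_i poissonp (lam i) (n i))%:E.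
  rewrite NE PX //; last first.
    move=> i j ij; rewrite -subset0 => x [xi xj].
    have /enum_val_inj ji : enum_val i = enum_val j by rewrite -xi -xj.
    by rewrite ji eqxx in ij.
  congr EFin; rewrite [RHS](_ : _ = \prod_(i in [pred _ : I | true]) poissonp (lam i) (n i)) //.
  rewrite (big_enum_val (A := [pred _ : I | true])).
  by [].
(* The j-th set of [l] is the union of the atoms whose pattern has bit j. *)
pose lE : seq (pred I) := [seq (fun i : I => i j) | j <- enum 'I_k].
have lEE : [seq (fun x => x \in A) | A <- l] = [seq (A \o c : pred T) | A <- lE].
  rewrite -map_comp; apply: (@eq_from_nth _ xpred0).
    by rewrite 2!size_map size_enum_ord.
  move=> j; rewrite size_map => jk; rewrite (nth_map set0) //.
  rewrite (nth_map (Ordinal jk)) ?size_enum_ord //; apply/funext => x /=.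
  by rewrite ffunE nth_enum_ord.
have lam0 i : 0 <= lam i by apply: fine_ge0.
have FE w : facsum [seq (fun x => x \in A) | A <- l] (X w) = facpoly lE (N w).
  by rewrite lEE facsum_facpoly.
split.
  under eq_fun do rewrite FE.
  exact: (measurable_countable_comp mN (fun n => ((facpoly lE n)%:R)%:E : \bar R)).
under eq_integral do rewrite FE.
rewrite (integral_facpoly lam0 mN PN) big_map big_enum /= (big_nth set0) big_mkord.
congr EFin; apply: eq_bigr => j _.
pose r := [seq i : I <- index_enum I | i j].
have ur : uniq r by apply/filter_uniq/index_enum_uniq.
have -> : nth set0 l j = \bigcup_(i in [set` r]) B i.
  apply/seteqP; split => x /=.
    by move=> xj; exists (c x) => //=; rewrite mem_filter ffunE mem_index_enum andbT inE.
  by move=> [i /=]; rewrite mem_filter => /andP[+ _] xi; rewrite -xi ffunE inE.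
rewrite measure_fin_bigcup; last 3 first.
- exact: finite_seq.
- by move=> i i' _ _ [x [xi xi']]; rewrite -xi -xi'.
- by move=> i _.
rewrite -fsbig_seq // -big_filter -/r.
by rewrite sum_fine // => i _; exact: finite_mu.
Qed.

End PoissonProcess.

(** * Campbell's formula *)

(** Written with Dirac masses so that additivity in [C], finite or countable, is inherited from
    measures. *)
Definition cnt (R : realType) (d : measure_display) (U : measurableType d)
  (C : set U) (s : seq U) : \bar R := (\sum_(u <- s) \d_u C)%E.

Lemma addeI_fin (R : realType) (x a b : \bar R) :
  x \is a fin_num -> (x + a = x + b)%E -> a = b.
Proof. by move=> xf e; rewrite -(addeK a xf) addeC [X in (_ + X)%E]addeC e [X in (_ + X)%E]addeC addeC addeK. Qed.

Section Campbell.
Context (dO : measure_display) (O : measurableType dO) (R : realType)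
  (P : probability O R).
Local Open Scope ereal_scope.

Lemma cnt_ge0 (d : measure_display) (U : measurableType d) (C : set U) s :
  0 <= cnt R C s.
Proof. by apply: sume_ge0 => u _. Qed.

Lemma cntE (d : measure_display) (U : measurableType d) (C : set U) s :
  cnt R C s = (count (fun u => u \in C) s)%:R%:E.
Proof.
rewrite /cnt; elim: s => [|u s IH]; first by rewrite big_nil.
by rewrite big_cons IH diracE /= natrD EFinD.
Qed.

Definition has_intensity (d : measure_display) (U : measurableType d)
  (Y : O -> seq U) (rho : set U -> \bar R) := forall C, measurable C ->
  measurable_fun setT (fun w => cnt R C (Y w)) /\
  \int[P]_w cnt R C (Y w) = rho C.

Section Sum.
Context (d : measure_display) (U : measurableType d) (Y : O -> seq U)
  (rho : {measure set U -> \bar R}).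
Hypothesis HY : has_intensity Y rho.
Import HBNNSimple.

Lemma campbell_nnsfun (g : {nnsfun U >-> R}) :
  measurable_fun setT (fun w => \sum_(u <- Y w) (g u)%:E) /\
  \int[P]_w (\sum_(u <- Y w) (g u)%:E) = \int[rho]_u (g u)%:E.
Proof.
pose r : seq R := finmap.enum_fset (fset_set (range g)).
pose A y := g @^-1` [set y].
have mA y : measurable (A y) by exact: measurable_sfunP.
have r0 y : y \in r -> (0 <= y)%R.
  by rewrite in_fset_set // inE => -[u _ <-].
(* On the values of [g] the maximum is [y] itself; it makes the coefficient nonnegative for every
   [y], as integrating the sum term by term requires. *)
have E s : \sum_(u <- s) (g u)%:E = \sum_(y <- r) (Num.max 0 y)%:E * cnt R (A y) s.
  under eq_bigr => u _.
    rewrite fimfunE fsbig_finite //= -sumEFin; over.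
  rewrite exchange_big /=; rewrite big_seq [RHS]big_seq; apply: eq_bigr => y yr.
  rewrite (max_r (r0 _ yr)) /cnt ge0_sume_distrr; last by move=> u _.
  by apply: eq_bigr => u _; rewrite EFinM.
have mc y : measurable_fun setT (fun w => (Num.max 0 y)%:E * cnt R (A y) (Y w)).
  by apply: measurable_funeM; case: (HY (mA y)).
split.
  by under eq_fun do rewrite E; apply: emeasurable_sum => y.
transitivity (\int[P]_w (\sum_(y <- r) (Num.max 0 y)%:E * cnt R (A y) (Y w))).
  by apply: eq_integral => w _; rewrite E.
rewrite ge0_integral_sum //; last first.
  by move=> y w _; rewrite mule_ge0 ?cnt_ge0 // lee_fin le_max lexx.
rewrite integralT_nnsfun sintegralE fsbig_finite //= big_seq [RHS]big_seq.
apply: eq_bigr => y yr; rewrite ge0_integralZl //.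
- by rewrite (max_r (r0 _ yr)); case: (HY (mA y)) => _ ->.
- by case: (HY (mA y)).
- by move=> w _; exact: cnt_ge0.
- by rewrite lee_fin le_max lexx.
Qed.

Lemma campbell (h : U -> \bar R) : measurable_fun setT h -> (forall u, 0 <= h u) ->
  measurable_fun setT (fun w => \sum_(u <- Y w) h u) /\
  \int[P]_w (\sum_(u <- Y w) h u) = \int[rho]_u h u.
Proof.
move=> mh h0; pose g := nnsfun_approx measurableT mh.
have cg u : (fun n => (g n u)%:E) @ \oo --> h u.
  by apply: (cvg_nnsfun_approx measurableT mh) => // x _.
have ndg u : nondecreasing_seq (fun n => (g n u)%:E).
  by move=> m n mn; rewrite lee_fin; exact/lefP/nd_nnsfun_approx.
have cs s : (fun n => \sum_(u <- s) (g n u)%:E) @ \oo --> \sum_(u <- s) h u.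
  elim: s => [|u s IH].
    by under eq_fun do rewrite big_nil; rewrite big_nil; exact: cvg_cst.
  under eq_fun do rewrite big_cons; rewrite big_cons; apply: cvgeD => //.
  by apply: ge0_adde_def; rewrite inE ?h0 // sume_ge0.
have mS n : measurable_fun setT (fun w => \sum_(u <- Y w) (g n u)%:E).
  by case: (campbell_nnsfun (g n)).
split; first by apply: (emeasurable_fun_cvg _ _ mS) => w _; exact: cs.
have S0 n w : setT w -> 0 <= \sum_(u <- Y w) (g n u)%:E.
  by move=> _; apply: sume_ge0 => u _; rewrite lee_fin.
have ndS w : setT w -> nondecreasing_seq (fun n => \sum_(u <- Y w) (g n u)%:E).
  by move=> _ m n mn; apply: lee_sum => u _; exact: ndg.
have mg n : measurable_fun setT (fun u => (g n u)%:E) by exact/measurable_EFinP.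
have g0 n u : setT u -> 0 <= (g n u)%:E by rewrite lee_fin.
have -> : \int[P]_w (\sum_(u <- Y w) h u)
   = \int[P]_w (limn (fun n => \sum_(u <- Y w) (g n u)%:E)).
  by apply: eq_integral => w _; apply/esym/cvg_lim.
have -> : \int[rho]_u h u = \int[rho]_u (limn (fun n => (g n u)%:E)).
  by apply: eq_integral => w _; apply/esym/cvg_lim.
rewrite (monotone_convergence P measurableT mS S0 ndS).
rewrite (monotone_convergence rho measurableT mg g0 (fun u _ => ndg u)).
by congr (limn _); apply/funext => n; case: (campbell_nnsfun (g n)).
Qed.

End Sum.

Section Product.
Context (d1 d2 : measure_display) (U1 : measurableType d1) (U2 : measurableType d2)
  (m1 : {sigma_finite_measure set U1 -> \bar R})
  (m2 : {sigma_finite_measure set U2 -> \bar R}) (c : R)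
  (Y : O -> seq (U1 * U2)).
Hypothesis c0 : (0 <= c)%R.
Hypothesis fin1 : m1 setT < +oo.
Hypothesis fin2 : m2 setT < +oo.
Hypothesis HR : forall A B, measurable A -> measurable B ->
  measurable_fun setT (fun w => cnt R (A `*` B) (Y w)) /\
  \int[P]_w cnt R (A `*` B) (Y w) = c%:E * (m1 A * m2 B).

(** Rectangles are a pi-system, and the sets on which the formula holds form a lambda-system. Finite
    total mass is what permits the subtraction in the complement step. *)
Lemma intensity_product : has_intensity Y (fun C => c%:E * sfprod m1 m2 C).
Proof.
pose rho C := c%:E * sfprod m1 m2 C.
pose G := [set A `*` B | A in @measurable _ U1 & B in @measurable _ U2].
pose H := [set C : set (U1 * U2) | measurable C /\
  (measurable_fun setT (fun w => cnt R C (Y w)) /\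
  \int[P]_w cnt R C (Y w) = rho C)].
suff GH : @measurable _ (U1 * U2)%type `<=` H.
  by move=> C /GH[].
have HG A B : measurable A -> measurable B -> H (A `*` B).
  move=> mA mB; split; first exact: measurableX.
  by have [mAB ->] := HR mA mB; split => //; rewrite /rho sfprodX.
have HT : H setT by rewrite -setXTT; exact: HG.
have rhoT : rho setT \is a fin_num.
  rewrite /rho -setXTT sfprodX // fin_numM // fin_numM //;
    by rewrite ge0_fin_numE.
rewrite measurable_prod_measurableType.
apply: (@lambda_system_subset _ G _ setT H).
- move=> _ _ [A mA [B mB <-]] [A' mA' [B' mB' <-]].
  exists (A `&` A'); first exact: measurableI.
  exists (B `&` B'); first exact: measurableI.
  by rewrite setXI.
- apply/dynkin_lambda_system; split => //.
  + move=> C [mC [mcC EC]]; split; first exact: measurableC.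
    have cC s : cnt R C s + cnt R (~` C) s = cnt R setT s.
      rewrite /cnt -big_split /=; apply: eq_bigr => u _.
      by rewrite !diracE in_setC in_setT; case: (u \in C) => /=; rewrite ?adde0 ?add0e.
    have mcC' : measurable_fun setT (fun w => cnt R (~` C) (Y w)).
      have -> : (fun w => cnt R (~` C) (Y w)) = (fun w => cnt R setT (Y w) - cnt R C (Y w)).
        by apply/funext => w; rewrite -cC (addeC (cnt R C _)) addeK // cntE.
      by apply: emeasurable_funB => //; case: HT => _ [].
    split => //.
    have rhoC : rho C + rho (~` C) = rho setT.
      rewrite /rho -ge0_muleDr // -measureU ?setUv ?setICr //; exact: measurableC.
    have rhof : rho C \is a fin_num.
      have r0 D : 0 <= rho D by rewrite mule_ge0 // lee_fin.
      rewrite ge0_fin_numE //; apply: (@le_lt_trans _ _ (rho setT)).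
        by rewrite -rhoC leeDl.
      by rewrite -ge0_fin_numE.
    apply: (addeI_fin rhof); rewrite rhoC -EC -ge0_integralD //; last 2 first.
    * by move=> w _; exact: cnt_ge0.
    * by move=> w _; exact: cnt_ge0.
    case: HT => _ [_ <-]; by apply: eq_integral => w _; rewrite cC.
  + move=> F tF HF; split; first by apply: bigcupT_measurable => i; case: (HF i).
    have cF s : cnt R (\bigcup_k F k) s = \sum_(k <oo) cnt R (F k) s.
      rewrite /cnt nneseries_sum; last by [].
      apply: eq_bigr => u _; rewrite measure_semi_bigcup //.
      * by move=> i; case: (HF i).
      * by apply: bigcupT_measurable => i; case: (HF i).
    have mF k : measurable_fun setT (fun w => cnt R (F k) (Y w)) by case: (HF k) => _ [].
    split.
      under eq_fun do rewrite cF.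
      by apply: ge0_emeasurable_sum => // k w _ _; exact: cnt_ge0.
    transitivity (\int[P]_w (\sum_(k <oo) cnt R (F k) (Y w))).
      by apply: eq_integral => w _; rewrite cF.
    rewrite integral_nneseries //; last by move=> k w _; exact: cnt_ge0.
    rewrite /rho measure_semi_bigcup //; last 2 first.
    * by move=> i; case: (HF i).
    * by apply: bigcupT_measurable => i; case: (HF i).
    rewrite -nneseriesZl //.
    by apply: eq_eseriesr => k _; case: (HF k) => _ [].
- by move=> _ [A mA [B mB <-]]; exact: HG.
- by [].
Qed.

End Product.
End Campbell.

(** * Second moments of sums over pairs *)

Section FactorialMeasures.
Context (dO : measure_display) (O : measurableType dO) (R : realType)
  (P : probability O R) (dT : measure_display) (T : measurableType dT)
  (mu : {sigma_finite_measure set T -> \bar R}) (X : O -> seq T).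
Hypothesis muT : (mu setT < +oo)%E.
Hypothesis mX : forall B, measurable B -> forall k : nat,
  measurable [set w | count (fun x => x \in B) (X w) = k].
Hypothesis PX : forall (k : nat) (B : 'I_k -> set T) (n : 'I_k -> nat),
  (forall i, measurable (B i)) ->
  (forall i j, i != j -> B i `&` B j = set0) ->
  P (\bigcap_(i in [set: 'I_k]) [set w | count (fun x => x \in B i) (X w) = n i])
  = (\prod_(i < k) poissonp (fine (mu (B i))) (n i))%:E.
Local Open Scope ereal_scope.

(** Iterated from [id], it lists the ordered pairs, triples and quadruples of entries at distinct
    positions, nested to the right. *)
Definition ext (U : Type) (Y : seq T -> seq U) (s : seq T) : seq (T * U) :=
  flatten [seq [seq (x, u) | u <- Y (rem x s)] | x <- s].

(* [prelist l Y s] concatenates the lists [Y s'] where [s'] is [s] with points of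
   A_1, ..., A_k (the sets of [l]) successively removed. Prescribing these first
   factors lets the pi-lambda argument treat one further factor at a time. *)
Fixpoint prelist (U : Type) (l : seq (set T)) (Y : seq T -> seq U) (s : seq T) :=
  if l is A :: l' then
    flatten [seq (if x \in A then prelist l' Y (rem x s) else [::]) | x <- s]
  else Y s.

Lemma big_flatten_map (U V : Type) (F : V -> seq U) (s : seq V) (h : U -> \bar R) :
  \sum_(u <- flatten [seq F x | x <- s]) h u = \sum_(x <- s) \sum_(u <- F x) h u.
Proof.
elim: s => [|x s IH]; first by rewrite !big_nil.
by rewrite /= big_cat big_cons IH.
Qed.

Lemma sum_ext (U : Type) (Y : seq T -> seq U) s (h : T * U -> \bar R) :
  \sum_(u <- ext Y s) h u = \sum_(x <- s) \sum_(u <- Y (rem x s)) h (x, u).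
Proof. by rewrite /ext big_flatten_map; apply: eq_bigr => x _; rewrite big_map. Qed.

Lemma cnt_prelist_cons d (U : measurableType d) A l (Y : seq T -> seq U) C s :
  cnt R C (prelist (A :: l) Y s) =
  \sum_(x <- s) (if x \in A then cnt R C (prelist l Y (rem x s)) else 0).
Proof.
rewrite /cnt /= big_flatten_map; apply: eq_bigr => x _.
by case: ifP => // _; rewrite big_nil.
Qed.

(** On a rectangle, the condition on the first coordinate is one more prescribed removal. This
    reduces a statement on [ext Y] to one on [Y] with a longer list. *)
Lemma cnt_prelist_ext d (U : measurableType d) l (Y : seq T -> seq U) A C s :
  cnt R (A `*` C) (prelist l (ext Y) s) = cnt R C (prelist (rcons l A) Y s).
Proof.
elim: l s => [|B l IH] s.
  rewrite cnt_prelist_cons /cnt /= sum_ext; apply: eq_bigr => x _.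
  case: ifPn => xA.
    by apply: eq_bigr => u _; rewrite !diracE in_setX /= xA.
  by apply: big1 => u _; rewrite diracE in_setX /= (negbTE xA).
rewrite rcons_cons !cnt_prelist_cons; apply: eq_bigr => x _.
by case: ifP => // _; rewrite IH.
Qed.

Lemma cnt_prelist_id l C s :
  cnt R C (prelist l id s)
  = (facsum [seq (fun x => x \in A) | A <- rcons l C] s)%:R%:E.
Proof.
elim: l s => [|A l IH] s.
  rewrite cntE /=; congr (_%:R%:E); rewrite -sum1_count.
  by apply: eq_bigr.
rewrite cnt_prelist_cons rcons_cons /= natr_sum -sumEFin [RHS]big_mkcond /=.
by apply: eq_bigr => x _; case: ifP => // _; rewrite IH.
Qed.

(** Quantifying over all lists [l] makes the property stable under [ext]; the empty list gives back
    the plain intensity of [Y]. *)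
Definition fac_intensity d (U : measurableType d) (Y : seq T -> seq U)
  (rho : set U -> \bar R) :=
  forall l, (forall A, A \in l -> measurable A) ->
  has_intensity P (fun w => prelist l Y (X w))
    (fun C => (\prod_(A <- l) fine (mu A))%:E * rho C).

Lemma fac_intensity1 : fac_intensity id mu.
Proof.
move=> l ml C mC.
have mlC A : A \in rcons l C -> measurable A.
  by rewrite mem_rcons inE => /orP[/eqP ->//|/ml].
have [mf Ef] := facsum_moment muT mX PX mlC.
have E : (fun w => cnt R C (prelist l id (X w))) =
  (fun w => (facsum [seq (fun x => x \in A) | A <- rcons l C] (X w))%:R%:E).
  by apply/funext => w; exact: cnt_prelist_id.
rewrite E; split => //; rewrite Ef -cats1 big_cat big_seq1 EFinM fineK //.
exact: finite_mu.
Qed.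

Lemma fac_intensityS d (U : measurableType d) (Y : seq T -> seq U)
  (rho : {sigma_finite_measure set U -> \bar R}) : rho setT < +oo ->
  fac_intensity Y rho -> fac_intensity (ext Y) (sfprod mu rho).
Proof.
move=> rhoT HY l ml; apply: intensity_product => //.
  by apply: prodr_ge0 => A _; exact: fine_ge0.
move=> A B mA mB.
have mlA A' : A' \in rcons l A -> measurable A'.
  by rewrite mem_rcons inE => /orP[/eqP ->//|/ml].
have [mf Ef] := HY _ mlA _ mB.
have E : (fun w => cnt R (A `*` B) (prelist l (ext Y) (X w))) =
  (fun w => cnt R B (prelist (rcons l A) Y (X w))).
  by apply/funext => w; exact: cnt_prelist_ext.
rewrite E; split => //; rewrite Ef -cats1 big_cat big_seq1 EFinM fineK //.
  by rewrite muleA.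
exact: finite_mu.
Qed.

Lemma fac_campbell d (U : measurableType d) (Y : seq T -> seq U)
  (rho : {measure set U -> \bar R}) (h : U -> \bar R) : fac_intensity Y rho ->
  measurable_fun setT h -> (forall u, 0 <= h u) ->
  measurable_fun setT (fun w => \sum_(u <- Y (X w)) h u) /\
  \int[P]_w (\sum_(u <- Y (X w)) h u) = \int[rho]_u h u.
Proof.
move=> HY; apply: campbell => C mC.
have [] := HY [::] (fun _ => ltac:(done)) C mC.
by rewrite big_nil mul1e.
Qed.

Lemma product_finite d (U : measurableType d) (rho : {sigma_finite_measure set U -> \bar R}) :
  rho setT < +oo -> (sfprod mu rho) setT < +oo.
Proof.
move=> rhoT; rewrite -setXTT sfprodX // lte_mul_pinfty //; exact: finite_mu.
Qed.

Local Notation mu2 := (sfprod mu mu).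
Local Notation mu3 := (sfprod mu mu2).

Lemma fac2 : fac_intensity (ext id) mu2.
Proof. exact: fac_intensityS fac_intensity1. Qed.

Lemma fac3 : fac_intensity (ext (ext id)) mu3.
Proof. by apply: fac_intensityS fac2; exact: product_finite. Qed.

Lemma fac4 : fac_intensity (ext (ext (ext id))) (sfprod mu mu3).
Proof. by apply: fac_intensityS fac3; do 2 apply: product_finite. Qed.

Definition dsum (f : T -> T -> R) (s : seq T) : R :=
  (\sum_(x <- s) \sum_(y <- rem x s) f x y)%R.

Section Moments.
Variables f g : T -> T -> R.
Hypothesis f0 : forall x y, (0 <= f x y)%R.
Hypothesis g0 : forall x y, (0 <= g x y)%R.
Hypothesis fC : forall x y, f x y = f y x.
Hypothesis gC : forall x y, g x y = g y x.
Hypothesis mf : measurable_fun setT (fun u : T * T => f u.1 u.2).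
Hypothesis mg : measurable_fun setT (fun u : T * T => g u.1 u.2).

Lemma dsumE (k : T -> T -> R) s : (dsum k s)%:E = \sum_(u <- ext id s) (k u.1 u.2)%:E.
Proof.
rewrite sum_ext /dsum -sumEFin; apply: eq_bigr => x _.
by rewrite -sumEFin.
Qed.

Lemma big_rem_real (h : T -> R) x s : x \in s ->
  (\sum_(y <- s) h y = h x + \sum_(y <- rem x s) h y)%R.
Proof. by move=> xs; rewrite (perm_big _ (perm_to_rem xs)) big_cons. Qed.

Lemma dsum_diag (k : T -> T -> R) s :
  (dsum k s = \sum_(x <- s) \sum_(y <- s) k x y - \sum_(x <- s) k x x)%R.
Proof.
rewrite /dsum -sumrB big_seq [RHS]big_seq; apply: eq_bigr => y ys.
by rewrite [X in (X - _)%R](big_rem_real _ ys) addrAC subrr add0r.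
Qed.

Lemma dsum_rem x s : x \in s ->
  (dsum g s = dsum g (rem x s) + 2 * \sum_(z <- rem x s) g x z)%R.
Proof.
move=> xs; rewrite !dsum_diag (big_rem_real (fun y => g y y) xs).
have -> : (\sum_(a <- s) \sum_(b <- s) g a b = (g x x + \sum_(b <- rem x s) g x b) +
   (\sum_(a <- rem x s) g x a + \sum_(a <- rem x s) \sum_(b <- rem x s) g a b))%R.
  rewrite (big_rem_real (fun a => \sum_(b <- s) g a b)%R xs) (big_rem_real (g x) xs).
  by congr (_ + _)%R; rewrite -big_split; apply: eq_bigr => a _; rewrite (big_rem_real (g a) xs) gC.
by ring.
Qed.

(** Two ordered pairs share no point, one point (four ways), or both points (two ways). Symmetry of
    [g] merges the four ways into two terms with a factor 2, and the last two ways into one term.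
    Removing x and then y from the second sum through [dsum_rem] produces exactly these terms. *)
Lemma dsum_mul s : ((dsum f s * dsum g s)%R%:E =
  \sum_(u <- ext (ext (ext id)) s) (f u.1 u.2.1 * g u.2.2.1 u.2.2.2)%R%:E +
  (\sum_(u <- ext (ext id) s) (2 * f u.1 u.2.1 * (g u.2.1 u.2.2 + g u.1 u.2.2))%R%:E +
  \sum_(u <- ext id s) (2 * f u.1 u.2 * g u.1 u.2)%R%:E)).
Proof.
rewrite sum_ext.
rewrite [X in _ = _ + (X + _)]sum_ext [X in _ = _ + (_ + X)]sum_ext.
rewrite -big_split -big_split /=.
rewrite /dsum mulr_suml -sumEFin big_seq [RHS]big_seq; apply: eq_bigr => x xs.
rewrite [X in _ = X + _]sum_ext [X in _ = _ + (X + _)]sum_ext -big_split -big_split /=.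
rewrite mulr_suml -sumEFin big_seq [RHS]big_seq; apply: eq_bigr => y ys.
rewrite -/(dsum g s) (dsum_rem xs) (dsum_rem ys) (big_rem_real (g x) ys).
rewrite sum_ext; under [X in _ = X + _]eq_bigr do rewrite sumEFin.
rewrite !sumEFin -!EFinD; congr EFin.
under [X in _ = (X + _)%R]eq_bigr do rewrite -mulr_sumr.
rewrite -mulr_sumr -mulr_sumr big_split /= -/(dsum g _).
by ring.
Qed.

Lemma measurable_kernel_comp (k : T -> T -> R) d (U : measurableType d) (a b : U -> T) :
  measurable_fun setT (fun u : T * T => k u.1 u.2) ->
  measurable_fun setT a -> measurable_fun setT b ->
  measurable_fun setT (fun u => k (a u) (b u)).
Proof.
move=> mk ma mb.
exact: (measurableT_comp mk (measurable_fun_pair ma mb)).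
Qed.

Definition kint (k : T -> T -> R) x := \int[mu]_y (k x y)%:E.

Lemma measurable_kint (k : T -> T -> R) : (forall x y, (0 <= k x y)%R) ->
  measurable_fun setT (fun u : T * T => k u.1 u.2) ->
  measurable_fun setT (kint k).
Proof.
move=> k0 mk.
have mk' : measurable_fun setT (fun u : T * T => (k u.1 u.2)%:E).
  exact/measurable_EFinP.
by apply: (@measurable_fun_fubini_tonelli_F _ _ _ _ _ mu _ mk') => u; rewrite lee_fin.
Qed.

Lemma kint_ge0 (k : T -> T -> R) x : (forall x y, (0 <= k x y)%R) -> 0 <= kint k x.
Proof. by move=> k0; apply: integral_ge0 => y _; rewrite lee_fin. Qed.

Lemma dsum_mean (k : T -> T -> R) : (forall x y, (0 <= k x y)%R) ->
  measurable_fun setT (fun u : T * T => k u.1 u.2) ->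
  measurable_fun setT (fun w => (dsum k (X w))%:E) /\
  \int[P]_w (dsum k (X w))%:E = \int[mu]_x kint k x.
Proof.
move=> k0 mk; have mk' : measurable_fun setT (fun u : T * T => (k u.1 u.2)%:E).
  exact/measurable_EFinP.
have [m E] := fac_campbell fac2 mk' (fun u => k0 u.1 u.2).
have DE : (fun w => (dsum k (X w))%:E) =
    (fun w => \sum_(u <- ext id (X w)) (k u.1 u.2)%:E).
  by apply/funext => w; rewrite dsumE.
rewrite DE; split => //.
by rewrite E integral_sfprod // => u; rewrite lee_fin.
Qed.

(** Campbell's formula is applied to each part of [dsum_mul]: disjoint pairs give the product of the
    means, and each of the four one-point coincidences gives the integral of [kint f x * kint g x].
    Taking two kernels instead of a square provides the mixed moment needed for a difference. *)
Lemma dsum_second_moment :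
  \int[P]_w (dsum f (X w) * dsum g (X w))%:E =
  (\int[mu]_x kint f x) * (\int[mu]_x kint g x) +
  (4%:E * \int[mu]_x (kint f x * kint g x) +
   2%:E * \int[mu]_x \int[mu]_y (f x y * g x y)%:E).
Proof.
have mF := measurable_kint f0 mf; have mG := measurable_kint g0 mg.
have F0 x := kint_ge0 x f0; have G0 x := kint_ge0 x g0.
pose h4 (u : T * (T * (T * T))) := (f u.1 u.2.1 * g u.2.2.1 u.2.2.2)%R%:E.
pose h3 (u : T * (T * T)) := (2 * f u.1 u.2.1 * (g u.2.1 u.2.2 + g u.1 u.2.2))%R%:E.
pose h2 (u : T * T) := (2 * f u.1 u.2 * g u.1 u.2)%R%:E.
have h40 u : 0 <= h4 u by rewrite lee_fin mulr_ge0.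
have h30 u : 0 <= h3 u by rewrite lee_fin !mulr_ge0 // addr_ge0.
have h20 u : 0 <= h2 u by rewrite lee_fin !mulr_ge0.
have m1 d1 (U1 : measurableType d1) : measurable_fun setT (fun u : T * U1 => u.1).
  exact: measurable_fst.
have m21 d1 (U1 : measurableType d1) : measurable_fun setT (fun u : T * (T * U1) => u.2.1).
  exact: (measurableT_comp measurable_fst measurable_snd).
have m22 d1 (U1 : measurableType d1) : measurable_fun setT (fun u : T * (T * U1) => u.2.2).
  exact: (measurableT_comp measurable_snd measurable_snd).
have m22' : measurable_fun setT (fun u : T * (T * T) => u.2.2).
  exact: (measurableT_comp measurable_snd measurable_snd).
have mh4 : measurable_fun setT h4.
  apply/measurable_EFinP; apply: measurable_funM.
    exact: (measurable_kernel_comp mf (m1 _ (T * (T * T))%type) (m21 _ (T * T)%type)).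
  exact: (measurable_kernel_comp mg
    (measurableT_comp measurable_fst (m22 _ (T * T)%type))
    (measurableT_comp measurable_snd (m22 _ (T * T)%type))).
have mh3 : measurable_fun setT h3.
  apply/measurable_EFinP; apply: measurable_funM.
    by apply: measurable_funM => //; exact: (measurable_kernel_comp mf (m1 _ (T * T)%type) (m21 _ T)).
  apply: measurable_funD; first exact: (measurable_kernel_comp mg (m21 _ T) m22').
  exact: (measurable_kernel_comp mg (m1 _ (T * T)%type) m22').
have mh2 : measurable_fun setT h2.
  by apply/measurable_EFinP; apply: measurable_funM => //; apply: measurable_funM.
have [m4 E4] := fac_campbell fac4 mh4 h40.
have [m3 E3] := fac_campbell fac3 mh3 h30.
have [m2 E2] := fac_campbell fac2 mh2 h20.
transitivity (\int[P]_w (\sum_(u <- ext (ext (ext id)) (X w)) h4 u +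
  (\sum_(u <- ext (ext id) (X w)) h3 u + \sum_(u <- ext id (X w)) h2 u))).
  by apply: eq_integral => w _; exact: dsum_mul.
have s0 U (h : U -> \bar R) s : (forall u, 0 <= h u) -> 0 <= \sum_(u <- s) h u.
  by move=> h0; apply: sume_ge0.
rewrite ge0_integralD //; [|by move=> w _; exact: s0| |]; last 2 first.
- by move=> w _; apply: adde_ge0; exact: s0.
- exact: emeasurable_funD.
rewrite ge0_integralD //; [|by move=> w _; exact: s0|by move=> w _; exact: s0].
rewrite E4 E3 E2; congr (_ + (_ + _)).
- rewrite integral_sfprod //.
  transitivity (\int[mu]_x (kint f x * \int[mu]_x kint g x)).
    apply: eq_integral => x _; rewrite integral_sfprod //; last first.
      apply: (measurableT_comp mh4); exact: measurable_fun_pair.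
    have Ig : \int[sfprod mu mu]_v (g v.1 v.2)%:E = \int[mu]_x kint g x.
      rewrite integral_sfprod //; first exact/measurable_EFinP.
      by move=> u; rewrite lee_fin.
    rewrite -ge0_integralZr //; last 3 first.
    + by apply/measurable_EFinP; apply: measurable_kernel_comp.
    + by move=> y _; rewrite lee_fin.
    + by apply: integral_ge0 => y _.
    apply: eq_integral => y _; rewrite -Ig -ge0_integralZl //.
    + exact/measurable_EFinP.
    + by move=> v _; rewrite lee_fin.
    + by rewrite lee_fin.
  by rewrite ge0_integralZr //; apply: integral_ge0 => y _.
- rewrite integral_sfprod //.
  have mkf x : measurable_fun setT (fun y => (f x y)%:E).
    by apply/measurable_EFinP; apply: measurable_kernel_comp.
  have mkg x : measurable_fun setT (fun y => (g x y)%:E).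
    by apply/measurable_EFinP; apply: measurable_kernel_comp.
  transitivity (\int[mu]_x (2%:E * \int[mu]_y ((f x y)%:E * kint g y) + 2%:E * (kint f x * kint g x))).
    apply: eq_integral => x _; rewrite integral_sfprod //; last first.
      apply: (measurableT_comp mh3); exact: measurable_fun_pair.
    transitivity (\int[mu]_y (2%:E * ((f x y)%:E * kint g y) + 2%:E * ((f x y)%:E * kint g x))).
      apply: eq_integral => y _ /=.
      transitivity (\int[mu]_z ((2 * f x y)%R%:E * ((g y z)%:E + (g x z)%:E))).
        by apply: eq_integral => z _.
      rewrite ge0_integralZl //; last 3 first.
      + by apply: emeasurable_funD; exact: mkg.
      + by move=> z _; rewrite adde_ge0 ?lee_fin.
      + by rewrite lee_fin mulr_ge0.
      rewrite ge0_integralD //; last 2 first.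
      + by move=> z _; rewrite lee_fin.
      + by move=> z _; rewrite lee_fin.
      by rewrite -/(kint g y) -/(kint g x) ge0_muleDr // EFinM !muleA.
    have mfG : measurable_fun setT (fun y => (f x y)%:E * kint g y).
      by apply: emeasurable_funM.
    have fG0 y z : 0 <= (f x y)%:E * kint g z by rewrite mule_ge0 ?lee_fin.
    rewrite ge0_integralD //; last 4 first.
    + by move=> y _; rewrite mule_ge0.
    + exact: measurable_funeM.
    + by move=> y _; rewrite mule_ge0.
    + by apply: measurable_funeM; apply: emeasurable_funM.
    rewrite !ge0_integralZl //; last by apply: emeasurable_funM.
    by rewrite ge0_integralZr // => y _; rewrite lee_fin.
  have mfG2 : measurable_fun setT (fun u : T * T => (f u.1 u.2)%:E * kint g u.2).
    apply: emeasurable_funM; first exact/measurable_EFinP.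
    exact: (measurableT_comp mG).
  have fG0 u : 0 <= (f u.1 u.2)%:E * kint g u.2 by rewrite mule_ge0 ?lee_fin.
  have mfG : measurable_fun setT (fun x => \int[mu]_y ((f x y)%:E * kint g y)).
    exact: (@measurable_fun_fubini_tonelli_F _ _ _ _ _ mu _ mfG2).
  have fGi x : 0 <= \int[mu]_y ((f x y)%:E * kint g y).
    by apply: integral_ge0 => y _; exact: (fG0 (x, y)).
  rewrite ge0_integralD //; last 4 first.
  + by move=> x _; rewrite mule_ge0.
  + exact: measurable_funeM.
  + by move=> x _; rewrite !mule_ge0.
  + by apply: measurable_funeM; apply: emeasurable_funM.
  rewrite !ge0_integralZl //; last 2 first.
  + exact: emeasurable_funM.
  + by move=> x _; rewrite mule_ge0.
  (* Here the shared point is the second argument of [f]; exchanging the integrals and using the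
     symmetry of [f] brings it to the first. *)
  have -> : \int[mu]_x \int[mu]_y ((f x y)%:E * kint g y) = \int[mu]_x (kint f x * kint g x).
    rewrite (fubini_tonelli (fun u : T * T => (f u.1 u.2)%:E * kint g u.2)) //=.
    apply: eq_integral => y _; rewrite ge0_integralZr //; last 2 first.
    + by apply/measurable_EFinP; apply: measurable_kernel_comp.
    + by move=> x _; rewrite lee_fin.
    by congr (_ * _); apply: eq_integral => x _; rewrite fC.
  rewrite -ge0_muleDl ?lee_fin // -EFinD.
  by congr (_%:E * _); rewrite -natrD.
- rewrite integral_sfprod // -ge0_integralZl //; last 2 first.
  + have m' : measurable_fun setT (fun u : T * T => (f u.1 u.2 * g u.1 u.2)%R%:E).
      by apply/measurable_EFinP; exact: measurable_funM.
    apply: (@measurable_fun_fubini_tonelli_F _ _ _ _ _ mu _ m') => u.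
    by rewrite lee_fin mulr_ge0.
  + by move=> x _; apply: integral_ge0 => y _; rewrite lee_fin mulr_ge0.
  apply: eq_integral => x _; rewrite -ge0_integralZl //.
  + by apply: eq_integral => y _; rewrite -EFinM mulrA.
  + by apply/measurable_EFinP; apply: measurable_funM; apply: measurable_kernel_comp.
  + by move=> y _; rewrite lee_fin mulr_ge0.
Qed.

End Moments.

Lemma bounded_integral (a : T -> R) (B : R) : (0 <= B)%R -> measurable_fun setT a ->
  (forall x, (0 <= a x <= B)%R) ->
  \int[mu]_x (a x)%:E = (fine (\int[mu]_x (a x)%:E))%:E.
Proof.
move=> B0 ma aB; rewrite fineK // ge0_fin_numE; last first.
  by apply: integral_ge0 => x _; rewrite lee_fin; case/andP: (aB x).
apply: (@le_lt_trans _ _ (\int[mu]_x (cst B%:E x))).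
  apply: ge0_le_integral => //.
  - by move=> x _; rewrite lee_fin; case/andP: (aB x).
  - exact/measurable_EFinP.
  - by move=> x _; rewrite lee_fin; case/andP: (aB x).
by rewrite integral_cst // lte_mul_pinfty // lee_fin.
Qed.

(** The one-point term keeps the difference [phi1 - phi2], where the cancellation takes place. The
    two-point term needs no cancellation and is bounded by the two squares. The common bound [B],
    with the finite mass of [mu], makes all the moments finite, so they can be subtracted. *)
Lemma dsum_chebyshev (f1 f2 : T -> T -> R) (phi1 phi2 : T -> R) (B eps : R) :
  (forall x y, (0 <= f1 x y)%R) -> (forall x y, (0 <= f2 x y)%R) ->
  (forall x y, f1 x y = f1 y x) -> (forall x y, f2 x y = f2 y x) ->
  measurable_fun setT (fun u : T * T => f1 u.1 u.2) ->
  measurable_fun setT (fun u : T * T => f2 u.1 u.2) ->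
  (forall x, kint f1 x = (phi1 x)%:E) -> (forall x, kint f2 x = (phi2 x)%:E) ->
  (forall x, (phi1 x <= B)%R) -> (forall x, (phi2 x <= B)%R) ->
  \int[mu]_x \int[mu]_y (f1 x y * f1 x y)%:E < +oo ->
  \int[mu]_x \int[mu]_y (f2 x y * f2 x y)%:E < +oo ->
  (0 < eps)%R ->
  (eps ^+ 2)%:E * P [set w | (eps < `|(dsum f1 (X w) - fine (\int[P]_w (dsum f1 (X w))%:E))
                     - (dsum f2 (X w) - fine (\int[P]_w (dsum f2 (X w))%:E))|)%R]
  <= 4%:E * \int[mu]_x ((phi1 x - phi2 x) ^+ 2)%:E +
     2%:E * (\int[mu]_x \int[mu]_y (f1 x y * f1 x y)%:E +
             \int[mu]_x \int[mu]_y (f2 x y * f2 x y)%:E).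
Proof.
move=> f10 f20 f1C f2C mf1 mf2 p1 p2 B1 B2 K1 K2 eps0.
pose A1 w := dsum f1 (X w); pose A2 w := dsum f2 (X w).
have [mA1' EA1] := dsum_mean f10 mf1; have [mA2' EA2] := dsum_mean f20 mf2.
have mA1 : measurable_fun setT A1 by exact/measurable_EFinP.
have mA2 : measurable_fun setT A2 by exact/measurable_EFinP.
have A10 w : (0 <= A1 w)%R by do 2 (apply: sumr_ge0 => ? _).
have A20 w : (0 <= A2 w)%R by do 2 (apply: sumr_ge0 => ? _).
have p10 x : (0 <= phi1 x)%R by rewrite -lee_fin -p1 kint_ge0.
have p20 x : (0 <= phi2 x)%R by rewrite -lee_fin -p2 kint_ge0.
have mp1 : measurable_fun setT phi1.
  have e : EFin \o phi1 = kint f1 by apply/funext => x /=; rewrite p1.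
  by apply/measurable_EFinP; rewrite e; exact: measurable_kint.
have mp2 : measurable_fun setT phi2.
  have e : EFin \o phi2 = kint f2 by apply/funext => x /=; rewrite p2.
  by apply/measurable_EFinP; rewrite e; exact: measurable_kint.
have mpp (a b : T -> R) : measurable_fun setT a -> measurable_fun setT b ->
  measurable_fun setT (fun x : T => a x * b x)%R by exact: measurable_funM.
have B0 : (0 <= B)%R by apply: le_trans (B1 point); exact: p10.
have bnd (a b : T -> R) : measurable_fun setT a -> measurable_fun setT b ->
    (forall x, 0 <= a x)%R -> (forall x, 0 <= b x)%R ->
    (forall x, a x <= B)%R -> (forall x, b x <= B)%R ->
  \int[mu]_x (a x * b x)%:E = (fine (\int[mu]_x (a x * b x)%:E))%:E.
  move=> ma mb a0 b0 aB bB; apply: (@bounded_integral _ (B * B)%R).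
  - exact: mulr_ge0.
  - exact: mpp.
  - by move=> x; rewrite mulr_ge0 //= ler_pM.
have kE a (b : T -> R) : (forall x, kint a x = (b x)%:E) -> \int[mu]_x kint a x = \int[mu]_x (b x)%:E.
  by move=> ab; apply: eq_integral => x _; rewrite ab.
have I1 := @bounded_integral phi1 B B0 mp1 (fun x => introT andP (conj (p10 x) (B1 x))).
have I2 := @bounded_integral phi2 B B0 mp2 (fun x => introT andP (conj (p20 x) (B2 x))).
set i1 := fine _ in I1; set i2 := fine _ in I2.
have EA1' : \int[P]_w (A1 w)%:E = i1%:E by rewrite EA1 (kE _ _ p1).
have EA2' : \int[P]_w (A2 w)%:E = i2%:E by rewrite EA2 (kE _ _ p2).
rewrite -/(A1 _) EA1' EA2' /=.
have i10 : (0 <= i1)%R by apply/fine_ge0/integral_ge0 => x _; rewrite lee_fin.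
have i20 : (0 <= i2)%R by apply/fine_ge0/integral_ge0 => x _; rewrite lee_fin.
have J11 := bnd _ _ mp1 mp1 p10 p10 B1 B1; have J12 := bnd _ _ mp1 mp2 p10 p20 B1 B2.
have J22 := bnd _ _ mp2 mp2 p20 p20 B2 B2.
set j11 := fine _ in J11; set j12 := fine _ in J12; set j22 := fine _ in J22.
rewrite (integral_sqrB mp1 mp2 p10 p20 J11 J22 J12).
pose KK (a b : T -> T -> R) := \int[mu]_x \int[mu]_y (a x y * b x y)%:E.
have mKK (a b : T -> T -> R) : (forall x y, 0 <= a x y)%R -> (forall x y, 0 <= b x y)%R ->
    measurable_fun setT (fun u : T * T => a u.1 u.2) ->
    measurable_fun setT (fun u : T * T => b u.1 u.2) ->
    KK a b = \int[sfprod mu mu]_u (a u.1 u.2 * b u.1 u.2)%:E.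
  move=> a0 b0 ma mb; rewrite integral_sfprod //.
    by apply/measurable_EFinP; exact: measurable_funM.
  by move=> u; rewrite lee_fin mulr_ge0.
have KK0 (a b : T -> T -> R) : (forall x y, 0 <= a x y)%R -> (forall x y, 0 <= b x y)%R -> 0 <= KK a b.
  by move=> a0 b0; do 2 (apply: integral_ge0 => ? _); rewrite lee_fin mulr_ge0.
(* Pointwise, f1 f2 <= f1^2 + f2^2. *)
have K12 : KK f1 f2 < +oo.
  rewrite mKK //; apply: (@le_lt_trans _ _ (KK f1 f1 + KK f2 f2)); last first.
    by rewrite lte_add_pinfty.
  rewrite !mKK // -integral_EFinD; last 4 first.
  - exact: measurable_funM.
  - exact: measurable_funM.
  - by move=> u; rewrite mulr_ge0.
  - by move=> u; rewrite mulr_ge0.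
  apply: ge0_le_integral => //.
  - by move=> u _; rewrite lee_fin mulr_ge0.
  - by apply/measurable_EFinP; exact: measurable_funM.
  - by apply/measurable_EFinP; apply: measurable_funD; exact: measurable_funM.
  - move=> u _; rewrite lee_fin.
    have := sqr_ge0 (f1 u.1 u.2 - f2 u.1 u.2); have := mulr_ge0 (f10 u.1 u.2) (f20 u.1 u.2).
    by nra.
have KF (a b : T -> T -> R) : 0 <= KK a b -> KK a b < +oo -> KK a b = (fine (KK a b))%:E.
  by move=> h h'; rewrite fineK // ge0_fin_numE.
have {}K1 := KF _ _ (KK0 _ _ f10 f10) K1.
have {}K2 := KF _ _ (KK0 _ _ f20 f20) K2.
have {}K12 := KF _ _ (KK0 _ _ f10 f20) K12.
have k120 : (0 <= fine (KK f1 f2))%R by apply/fine_ge0/KK0.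
rewrite -!/(KK _ _) K1 K2.
set k11 := fine _ in K1 *; set k22 := fine _ in K2 *; set k12 := fine _ in K12 k120.
have E11 := dsum_second_moment f10 f10 f1C f1C mf1 mf1.
have E12 := dsum_second_moment f10 f20 f1C f2C mf1 mf2.
have E22 := dsum_second_moment f20 f20 f2C f2C mf2 mf2.
have kkE a a' (b b' : T -> R) : (forall x, kint a x = (b x)%:E) -> (forall x, kint a' x = (b' x)%:E) ->
   \int[mu]_x (kint a x * kint a' x) = \int[mu]_x (b x * b' x)%:E.
  by move=> ab ab'; apply: eq_integral => x _; rewrite ab ab'.
rewrite (kE _ _ p1) I1 (kkE _ _ _ _ p1 p1) J11 -/(KK _ _) K1 -!EFinM -!EFinD in E11.
rewrite (kE _ _ p2) I2 (kkE _ _ _ _ p2 p2) J22 -/(KK _ _) K2 -!EFinM -!EFinD in E22.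
rewrite (kE _ _ p1) (kE _ _ p2) I1 I2 (kkE _ _ _ _ p1 p2) J12 -/(KK _ _) K12 -!EFinM -!EFinD in E12.
(* The centred difference is regrouped as [(A1 + i2) - (A2 + i1)], a difference of nonnegative
   functions to which [integral_sqrB] applies. *)
have mq : measurable_fun setT (fun w => ((A1 w + i2) - (A2 w + i1)) ^+ 2)%R.
  by apply: measurable_funX; apply: measurable_funB; exact: measurable_funD.
have cstP (c : R) : \int[P]_w c%:E = c%:E.
  have PT : P setT = 1 by exact: probability_setT.
  transitivity (c%:E * P setT); last by rewrite PT mule1.
  exact: (integral_cst P measurableT).
have SQ (A A' : O -> R) (i i' ii e0 e1: R) : measurable_fun setT A -> measurable_fun setT A' ->
    (forall w, 0 <= A w)%R -> (forall w, 0 <= A' w)%R -> (0 <= i)%R -> (0 <= i')%R ->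
    \int[P]_w (A w)%:E = e0%:E -> \int[P]_w (A' w)%:E = e1%:E ->
    \int[P]_w (A w * A' w)%:E = ii%:E ->
    \int[P]_w ((A w + i) * (A' w + i'))%:E = (ii + i' * e0 + i * e1 + i * i')%R%:E.
  move=> mA mA' A0 A'0 i0 i'0 e_0 e_1 eii.
  rewrite !EFinD 2!EFinM -eii -e_0 -e_1 -!integral_EFinZ // -(cstP (i * i')%R).
  have mAA : measurable_fun setT (fun w => A w * A' w)%R by exact: measurable_funM.
  have miA : measurable_fun setT (fun w => i' * A w)%R by exact: measurable_funM.
  have miA' : measurable_fun setT (fun w => i * A' w)%R by exact: measurable_funM.
  have z1 w : (0 <= A w * A' w)%R by rewrite mulr_ge0.
  have z2 w : (0 <= i' * A w)%R by rewrite mulr_ge0.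
  have z3 w : (0 <= i * A' w)%R by rewrite mulr_ge0.
  rewrite -integral_EFinD // -integral_EFinD //; last 2 first.
  - exact: measurable_funD.
  - by move=> w; rewrite addr_ge0.
  rewrite -integral_EFinD //; last 3 first.
  - by do 2 apply: measurable_funD => //.
  - by move=> w; rewrite !addr_ge0.
  - by move=> w; rewrite mulr_ge0.
  by apply: eq_integral => w _; congr EFin; ring.
(* Each of the three second moments contains (i1 + i2)^2 exactly once, so the means cancel. *)
have Q : \int[P]_w (((A1 w + i2) - (A2 w + i1)) ^+ 2)%:E
   = (4 * (j11 + j22 - 2 * j12) + 2 * (k11 + k22 - 2 * k12))%R%:E.
  have S11 := SQ _ _ _ _ _ _ _ mA1 mA1 A10 A10 i20 i20 EA1' EA1' E11.
  have S22 := SQ _ _ _ _ _ _ _ mA2 mA2 A20 A20 i10 i10 EA2' EA2' E22.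
  have S12 := SQ _ _ _ _ _ _ _ mA1 mA2 A10 A20 i20 i10 EA1' EA2' E12.
  rewrite (integral_sqrB _ _ _ _ S11 S22 S12).
  - by congr EFin; ring.
  - exact: measurable_funD.
  - exact: measurable_funD.
  - by move=> w; rewrite addr_ge0.
  - by move=> w; rewrite addr_ge0.
set S := [set w | _].
have SE : S = [set w | (eps ^+ 2 < ((A1 w + i2) - (A2 w + i1)) ^+ 2)%R].
  apply/seteqP; split => w /=.
    rewrite -[X in (_ -> _ < X)%R]real_normK ?num_real // => h.
    rewrite ltr_pXn2r ?nnegrE ?(ltW eps0) //.
    by rewrite (_ : (A1 w + i2 - (A2 w + i1) = A1 w - i1 - (A2 w - i2))%R) //; ring.
  rewrite -[X in (_ < X -> _)%R]real_normK ?num_real // ltr_pXn2r ?nnegrE ?(ltW eps0) //.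
  by rewrite (_ : (A1 w + i2 - (A2 w + i1) = A1 w - i1 - (A2 w - i2))%R) //; ring.
have mS : measurable S.
  have mc : measurable_fun setT (fun _ : O => eps ^+ 2)%R by [].
  have := measurable_fun_ltr mc mq measurableT (Y := [set true]) Logic.I.
  by rewrite setTI SE.
apply: (@le_trans _ _ (\int[P]_w (((A1 w + i2) - (A2 w + i1)) ^+ 2)%:E)).
  rewrite -integral_cst //.
  apply: (@le_trans _ _ (\int[P]_(w in S) (((A1 w + i2) - (A2 w + i1)) ^+ 2)%:E)).
    apply: ge0_le_integral => //.
    - by move=> w _; rewrite lee_fin sqr_ge0.
    - by apply/measurable_EFinP; exact: measurable_funTS.
    - by move=> w; rewrite SE /= => /ltW h; rewrite lee_fin.
  apply: ge0_subset_integral => //.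
  - exact/measurable_EFinP.
  - by move=> w _; rewrite lee_fin sqr_ge0.
(* The mixed term -4 [k12] is at most 0 and is dropped. *)
by rewrite Q -!EFinM -!EFinD lee_fin; lra.
Qed.

End FactorialMeasures.

(** * Lebesgue measure on tuples *)

Section LebesgueTuple.
Variable R : realType.
Local Open Scope ereal_scope.

(* [lebesgue_measure] lives on [measurableTypeR R], whose measure display is not the
   one carried by [R] inside tuples. *)
Definition consp n (u : measurableTypeR R * n.-tuple R) : n.+1.-tuple R := cons_tuple u.1 u.2.

Lemma measurable_consp n : measurable_fun setT (@consp n).
Proof. exact: measurable_cons. Qed.

Lemma nil_sigma_finite : sigma_finite setT (@dirac _ (0.-tuple R) [tuple] R).
Proof.
exists (fun=> setT); first by rewrite bigcup_const.
by move=> _; split => //; rewrite diracT ltry.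
Qed.

Section Step.
Context (n : nat) (m : {sigma_finite_measure set (n.-tuple R) -> \bar R}).

Definition consm : set (n.+1.-tuple R) -> \bar R :=
  pushforward (sfprod (@lebesgue_measure R) m) (@consp n).

HB.instance Definition _ := Measure.copy consm
  (measure_function_pushforward__canonical__measure_function_Measure
     (sfprod (@lebesgue_measure R) m) (@measurable_consp n)).

Lemma consm_sigma_finite : sigma_finite setT consm.
Proof.
have [F TF Ff] := sigma_finiteT (sfprod (@lebesgue_measure R) m).
pose uncons (v : n.+1.-tuple R) : measurableTypeR R * n.-tuple R :=
  (thead v, [tuple of behead v]).
have consK : cancel (@consp n) uncons.
  by move=> [x v]; congr (_, _); apply/val_inj.
have mb : measurable_fun setT uncons.
  apply: measurable_fun_pair; first exact: measurable_tnth.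
  apply/measurable_fun_tnthP => i.
  rewrite (_ : _ \o _ = fun v : n.+1.-tuple R => tnth v (inord i.+1)).
    exact: measurable_tnth.
  by apply/funext => v /=; exact: tnth_behead.
exists (fun k => uncons @^-1` F k).
  apply/seteqP; split => // v _.
  have [k _ Fk] : (\bigcup_i F i) (uncons v) by rewrite -TF.
  by exists k.
move=> k; have [mF fF] := Ff k; split.
  by rewrite -[X in measurable X]setTI; exact: mb.
rewrite /consm /pushforward /= -comp_preimage.
rewrite (_ : _ @^-1` _ = F k) //; apply/seteqP; split => u /=; by rewrite consK.
Qed.

HB.instance Definition _ := Measure_isSigmaFinite.Build _ _ _ consm consm_sigma_finite.
End Step.

HB.instance Definition _ := Measure_isSigmaFinite.Build _ _ _
  (@dirac _ (0.-tuple R) [tuple] R) nil_sigma_finite.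

Fixpoint lebm (n : nat) : {sigma_finite_measure set (n.-tuple R) -> \bar R} :=
  match n with
  | 0 => @dirac _ (0.-tuple R) [tuple] R
  | n'.+1 => consm (lebm n')
  end.

(** Both sides unfold to the same iterated integral of sections, so the equality holds for every
    set. It gives access to measure theory for [lebesgue_d]. *)
Lemma lebmE n A : lebesgue_d A = lebm n A.
Proof.
elim: n A => [|n IH] A /=.
  rewrite diracE; case: asboolP => [a|a].
    by rewrite mem_set.
  by rewrite memNset.
apply: eq_integral => x _; rewrite IH /= /xsection /=; congr (lebm n _).
by apply/seteqP; split => v /=; rewrite inE.
Qed.

Lemma integral_lebmS n (f : n.+1.-tuple R -> \bar R) :
  measurable_fun setT f -> (forall v, 0 <= f v) ->
  \int[lebm n.+1]_v f v = \int[@lebesgue_measure R]_x \int[lebm n]_v f (consp (x, v)).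
Proof.
move=> mf f0.
transitivity (\int[sfprod (@lebesgue_measure R) (lebm n)]_u f (consp u)).
  have := @ge0_integral_pushforward _ _ _ _ _ _ (@measurable_consp n)
    (sfprod (@lebesgue_measure R) (lebm n)) setT f measurableT mf.
  by rewrite preimage_setT => <-.
rewrite integral_sfprod //.
exact: (measurableT_comp mf (@measurable_consp n)).
Qed.

(** By uniqueness of Lebesgue measure: q times its image under x -> q x + a gives half-open
    intervals their length. *)
Lemma lebesgue_affine (a q : R) : (0 < q)%R ->
  forall A : set R, measurable A ->
  lebesgue_measure ((fun x : R => q * x + a)%R @^-1` A) = (q^-1)%:E * @lebesgue_measure R A.
Proof.
move=> q0 A mA.
have mh : measurable_fun setT (fun x : measurableTypeR R => q * x + a : measurableTypeR R)%R.
  have h : measurable_fun setT (fun x : R => q * x + a)%R.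
    by apply: measurable_funD => //; exact: measurable_funM.
  exact: h.
pose mu' := mscale (NngNum (ltW q0)) (measure_function_pushforward__canonical__measure_function_Measure
     (@lebesgue_measure R) mh).
have E : @lebesgue_measure R A = mu' A.
  apply: (@lebesgue_measure_unique R mu') => // X.
  move=> /ocitvP[->|[[x y] /= xy ->]]; first by rewrite !measure0.
  rewrite /mu' /mscale /= /pushforward.
  rewrite (_ : _ @^-1` _ = `](x - a) / q, (y - a) / q]%classic)%R; last first.
    apply/seteqP; split => z /=; rewrite !in_itv /= ltr_pdivrMr // ler_pdivlMr // mulrC ltrBlDr lerBrDr.
      by [].
    by [].
  rewrite !lebesgue_measure_itv /= !lte_fin xy ltr_pM2r ?invr_gt0 // ltrD2r xy.
  rewrite -!EFinB -EFinM; congr EFin.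
  by field; rewrite gt_eqF.
by rewrite E /mu' /mscale /= muleA -EFinM mulVf ?gt_eqF // mul1e.
Qed.

Lemma integral_lebesgue_affine (a q : R) (h : R -> \bar R) : (0 < q)%R ->
  measurable_fun setT h -> (forall x, 0 <= h x) ->
  \int[@lebesgue_measure R]_x h (q * x + a)%R = (q^-1)%:E * \int[@lebesgue_measure R]_x h x.
Proof.
move=> q0 mh h0.
have mf : measurable_fun setT (fun x : measurableTypeR R => q * x + a : measurableTypeR R)%R.
  have m' : measurable_fun setT (fun x : R => q * x + a)%R.
    by apply: measurable_funD => //; exact: measurable_funM.
  exact: m'.
have q0' : (0 <= q^-1)%R by rewrite invr_ge0 ltW.
have mh' : measurable_fun setT (h : measurableTypeR R -> \bar R) by exact: mh.
transitivity (\int[pushforward (@lebesgue_measure R) (fun x : measurableTypeR R => q * x + a : measurableTypeR R)%R]_x h x).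
  by rewrite (ge0_integral_pushforward mf _ measurableT mh') // => x _; exact: h0.
rewrite -(ge0_integral_mscale _ measurableT (NngNum q0') mh') //.
apply: eq_measure_integral => A mA _ /=.
by rewrite /pushforward /mscale /= lebesgue_affine.
Qed.

Definition aff n (q : R) (a v : n.-tuple R) : n.-tuple R :=
  [tuple q * tnth v i + tnth a i | i < n]%R.

Lemma measurable_aff n q (a : n.-tuple R) : measurable_fun setT (aff q a).
Proof.
apply/measurable_fun_tnthP => i.
rewrite (_ : _ \o _ = fun v : n.-tuple R => (q * tnth v i + tnth a i)%R).
  apply: measurable_funD => //; apply: measurable_funM => //.
  exact: measurable_tnth.
by apply/funext => v /=; rewrite tnth_mktuple.
Qed.

Lemma aff_consp n q (a : n.+1.-tuple R) x (v : n.-tuple R) :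
  aff q a (consp (x, v)) = consp ((q * x + thead a)%R, aff q [tuple of behead a] v).
Proof.
apply: eq_from_tnth => i; rewrite tnth_mktuple.
case: (unliftP ord0 i) => [j|] -> /=.
  by rewrite /consp /= !tnthS tnth_mktuple; congr (_ + _)%R; rewrite {1}(tuple_eta a) tnthS.
by [].
Qed.

(** Change of variables one coordinate at a time; it contains the translation and dilation rules on
    which the radial computations rest. *)
Lemma integral_aff n q (a : n.-tuple R) (f : n.-tuple R -> \bar R) : (0 < q)%R ->
  measurable_fun setT f -> (forall v, 0 <= f v) ->
  \int[lebm n]_v f (aff q a v) = ((q^-1) ^+ n)%:E * \int[lebm n]_v f v.
Proof.
move=> q0; elim: n a f => [|n IH] a f mf f0.
  rewrite expr0 mul1e; apply: eq_integral => v _; congr f.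
  by rewrite [LHS]tuple0 [RHS]tuple0.
rewrite integral_lebmS //; last exact: (measurableT_comp mf (measurable_aff q a)).
have mfx x : measurable_fun setT (fun v : n.-tuple R => f (consp (x, v))).
  apply: (measurableT_comp mf); apply: (measurableT_comp (@measurable_consp n)).
  exact: measurable_fun_pair.
have mH : measurable_fun setT (fun x : R => \int[lebm n]_v f (consp (x, v))).
  have mfc : measurable_fun setT (f \o @consp n).
    exact: (measurableT_comp mf (@measurable_consp n)).
  exact: (@measurable_fun_fubini_tonelli_F _ _ _ _ _ (lebm n) _ mfc (fun u => f0 (consp u))).
have H0 x : 0 <= \int[lebm n]_v f (consp (x, v)) by apply: integral_ge0.
transitivity (\int[@lebesgue_measure R]_x
   (((q^-1) ^+ n)%:E * \int[lebm n]_v f (consp ((q * x + thead a)%R, v)))).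
  apply: eq_integral => x _.
  rewrite -(IH [tuple of behead a]) //.
  by apply: eq_integral => v _; rewrite aff_consp.
have q0' : (0 <= q^-1)%R by rewrite invr_ge0 ltW.
rewrite ge0_integralZl //; last 2 first.
- have m' : measurable_fun setT (fun x : R => q * x + thead a)%R.
    by apply: measurable_funD => //; exact: measurable_funM.
  exact: (measurableT_comp mH m').
- by rewrite lee_fin exprn_ge0.
rewrite (integral_lebesgue_affine _ q0 mH H0) integral_lebmS // muleA -EFinM.
by rewrite -exprSr.
Qed.

Definition cube n (r : R) : set (n.-tuple R) := [set v | forall i, (`|tnth v i| <= r)%R].

Lemma measurable_cube n r : measurable (@cube n r).
Proof.
rewrite (_ : cube r = \bigcap_(i in [set: 'I_n]) ((fun v : n.-tuple R => tnth v i) @^-1` `[-r, r]%classic)%R).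
  apply: fin_bigcap_measurable; first exact: finite_finset.
  move=> i _; have mI : measurable (`[(- r)%R, r]%classic : set R) by exact: measurable_itv.
  by have := @measurable_tnth _ R n i measurableT _ mI; rewrite setTI.
apply/seteqP; split => v /=.
  by move=> h i _ /=; rewrite in_itv /= -ler_norml.
by move=> h i; have := h i Logic.I; rewrite /= in_itv /= -ler_norml.
Qed.

Lemma lebm_cube n r : lebm n (@cube n r) < +oo.
Proof.
elim: n => [|n IH]; first by rewrite /= diracE ltry.
rewrite /= /consm /pushforward.
rewrite (_ : _ @^-1` _ = (`[-r, r]%classic)%R `*` @cube n r); last first.
  apply/seteqP; split => -[x v] /=.
    move=> h; split => /=; first by have := h ord0; rewrite in_itv /= -ler_norml.
    by move=> i; have := h (lift ord0 i); rewrite tnthS.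
  move=> [xr vr] i; case: (unliftP ord0 i) => [j|] ->; first by rewrite tnthS.
  by move: xr; rewrite /= in_itv /= -ler_norml.
have mI : measurable (`[(- r)%R, r]%classic : set R) by exact: measurable_itv.
rewrite sfprodX //; last exact: measurable_cube.
have fI : @lebesgue_measure R `[(- r)%R, r]%classic \is a fin_num.
  by rewrite lebesgue_measure_itv; case: ifP.
by rewrite lte_mul_pinfty.
Qed.

End LebesgueTuple.

(** * Radial integrals *)

(** Both sides vanish at h = 0, with derivatives a J and D k there, and the conclusion compares
    these derivatives. The limit is replaced by one sufficiently small h. *)
Lemma exp_ratio_le (R : realType) (a D J k c : R) : 0 < a -> 0 < D -> 0 <= J -> 0 <= k -> 0 <= c ->
  (forall h, 0 < h -> J * (1 - expR (- (a * h))) <= k * (1 - expR (- (D * h))) * expR (c * h)) ->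
  a * J <= D * k.
Proof.
move=> a0 D0 J0 k0 c0 H; rewrite leNgt; apply/negP => lt.
have aJ : 0 < a * J by apply: le_lt_trans lt; rewrite mulr_ge0 // ltW.
(* Chosen so that a J (a + c) h is half of the gap a J - D k. The hypothesis yields a J exp(-(a+c)
   h) <= D k, and exp(-u) >= 1 - u then makes the gap at most its half. *)
pose h := (a * J - D * k) / (2 * (a * J) * (a + c)).
have ac : 0 < a + c by lra.
have h0 : 0 < h.
  by apply: divr_gt0; [rewrite subr_gt0|apply: mulr_gt0 => //; apply: mulr_gt0].
have hE : a * J * ((a + c) * h) = (a * J - D * k) / 2.
  have J0' : J != 0 by apply: contraTneq aJ => ->; rewrite mulr0 ltxx.
  by rewrite /h; field; rewrite ?(gt_eqF ac) ?J0' ?(gt_eqF a0).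
have {}H := H _ h0.
set x := expR (- (a * h)) in H; set y := expR (- (D * h)) in H; set z := expR (c * h) in H.
have x0 : 0 < x := expR_gt0 _; have y0 : 0 < y := expR_gt0 _; have z0 : 0 < z := expR_gt0 _.
have h1 : a * h * x <= 1 - x.
  have : (1 + a * h) * x <= expR (a * h) * x by rewrite ler_pM2r // expR_ge1Dx.
  by rewrite /x -expRD subrr expR0; lra.
have h2 : 1 - y <= D * h by have := expR_ge1Dx (- (D * h)); rewrite -/y; lra.
have h3 : J * (a * h * x) <= k * (D * h) * z.
  apply: le_trans (ler_wpM2l J0 h1) _; apply: le_trans H _.
  by rewrite ler_pM2r // ler_wpM2l.
have h4 : a * J * x <= D * k * z.
  by rewrite -(ler_pM2r h0); nra.
have xz : x / z = expR (- ((a + c) * h)).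
  by rewrite /x /z -expRN -expRD; congr expR; ring.
have h5 : a * J * (x / z) <= D * k by rewrite mulrA ler_pdivrMr.
have h6 := expR_ge1Dx (- ((a + c) * h)); rewrite -xz in h6.
have h7 : a * J * (1 + - ((a + c) * h)) <= D * k.
  by apply: le_trans h5; rewrite ler_pM2l.
by rewrite mulrDr mulrN hE mulr1 in h7; lra.
Qed.

Section Radial.
Context (R : realType) (d : nat).
Hypothesis d0 : (0 < d)%N.
Local Open Scope ereal_scope.
Local Notation T := (d.-tuple R).
Local Notation zero := ([tuple of nseq d 0%R] : T).

Lemma edist_ge0 (x y : T) : (0 <= edist x y)%R.
Proof. exact: sqrtr_ge0. Qed.

Lemma edistC (x y : T) : edist x y = edist y x.
Proof. by congr Num.sqrt; apply: eq_bigr => i _; rewrite -sqrrN opprB. Qed.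

Lemma coord_le_edist (x y : T) i : (`|tnth x i - tnth y i| <= edist x y)%R.
Proof.
rewrite -sqrtr_sqr ler_wsqrtr // (bigD1 i) //= lerDl.
by apply: sumr_ge0 => j _; exact: sqr_ge0.
Qed.

Lemma edist_translate (x z : T) : edist x (aff 1 x z) = edist zero z.
Proof.
congr Num.sqrt; apply: eq_bigr => i _; rewrite tnth_mktuple tnth_nseq.
by rewrite mul1r -sqrrN opprB addrK sub0r sqrrN.
Qed.

Lemma edist_scale (q : R) (z : T) : (0 <= q)%R ->
  edist zero (aff q zero z) = (q * edist zero z)%R.
Proof.
move=> q0; rewrite /edist -[X in (X * _)%R]ger0_norm // -[X in (X * _)%R]sqrtr_sqr.
rewrite -sqrtrM ?sqr_ge0 //; congr Num.sqrt; rewrite mulr_sumr.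
apply: eq_bigr => i _; rewrite tnth_mktuple tnth_nseq addr0 !sub0r !sqrrN.
by rewrite exprMn.
Qed.

Lemma measurable_edist : measurable_fun setT (fun u : T * T => edist u.1 u.2).
Proof.
rewrite (_ : (fun u => _) = fun u : T * T =>
   ((\sum_(i < d) (tnth u.1 i - tnth u.2 i) ^+ 2) `^ 2^-1)%R); last first.
  by apply/funext => u; rewrite powR12_sqrt // sumr_ge0 // => i _; exact: sqr_ge0.
apply: (measurableT_comp (measurable_powR _)); apply: measurable_sum => i.
apply: measurable_funX; apply: measurable_funB.
- exact: (measurableT_comp (measurable_tnth i) measurable_fst).
- exact: (measurableT_comp (measurable_tnth i) measurable_snd).
Qed.

Lemma measurable_edistr x : measurable_fun setT (fun z : T => edist x z).
Proof.
exact: (measurableT_comp measurable_edist (measurable_fun_pair (measurable_cst x) (@measurable_id _ _ setT))).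
Qed.

Definition rint (psi : R -> R) := \int[lebm R d]_z (psi (edist zero z))%:E.

Lemma measurable_radial (psi : R -> R) : measurable_fun setT psi ->
  measurable_fun setT (fun z : T => psi (edist zero z)).
Proof. by move=> mpsi; exact: (measurableT_comp mpsi (measurable_edistr zero)). Qed.

Lemma rint_scale (psi : R -> R) q : (0 < q)%R -> measurable_fun setT psi ->
  (forall r, (0 <= psi r)%R) ->
  rint (fun r => psi (q * r)%R) = ((q^-1) ^+ d)%:E * rint psi.
Proof.
move=> q0 mpsi psi0; rewrite /rint -(integral_aff zero q0); last 2 first.
- by apply/measurable_EFinP; exact: measurable_radial.
- by move=> z; rewrite lee_fin.
by apply: eq_integral => z _; rewrite edist_scale // ltW.
Qed.

Lemma rint_translate (psi : R -> R) x : measurable_fun setT psi ->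
  (forall r, (0 <= psi r)%R) ->
  \int[lebm R d]_y (psi (edist x y))%:E = rint psi.
Proof.
move=> mpsi psi0.
have := @integral_aff R d 1%R x (fun y => (psi (edist x y))%:E) ltr01.
rewrite invr1 expr1n mul1e => <-.
- by apply: eq_integral => z _; rewrite edist_translate.
- by apply/measurable_EFinP; exact: (measurableT_comp mpsi (measurable_edistr x)).
- by move=> y; rewrite lee_fin.
Qed.

Lemma rint_ge0 (psi : R -> R) : (forall r, (0 <= psi r)%R) -> 0 <= rint psi.
Proof. by move=> psi0; apply: integral_ge0 => z _; rewrite lee_fin. Qed.

Lemma rintD (psi chi : R -> R) : measurable_fun setT psi -> measurable_fun setT chi ->
  (forall r, (0 <= psi r)%R) -> (forall r, (0 <= chi r)%R) ->
  rint (fun r => psi r + chi r)%R = rint psi + rint chi.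
Proof. by move=> *; rewrite /rint integral_EFinD //; exact: measurable_radial. Qed.

Lemma rintZ (c : R) (psi : R -> R) : (0 <= c)%R -> measurable_fun setT psi ->
  (forall r, (0 <= psi r)%R) -> rint (fun r => c * psi r)%R = c%:E * rint psi.
Proof. by move=> *; rewrite /rint integral_EFinZ //; exact: measurable_radial. Qed.

Lemma eq_rint (psi chi : R -> R) : (forall r, (0 <= r)%R -> psi r = chi r) -> rint psi = rint chi.
Proof. by move=> e; apply: eq_integral => z _; rewrite e // edist_ge0. Qed.

Lemma le_rint (psi chi : R -> R) : measurable_fun setT psi -> measurable_fun setT chi ->
  (forall r, (0 <= psi r)%R) -> (forall r, (psi r <= chi r)%R) -> rint psi <= rint chi.
Proof.
move=> mpsi mchi psi0 le; apply: ge0_le_integral => //.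
- by move=> z _; rewrite lee_fin.
- by apply/measurable_EFinP; exact: measurable_radial.
- by apply/measurable_EFinP; exact: measurable_radial.
- by move=> z _; rewrite lee_fin.
Qed.

Definition bal (q r : R) : R := if (r <= q)%R then 1%R else 0%R.
Definition shl (q p r : R) : R := if (q < r)%R && (r <= 1)%R then (r `^ p)%R else 0%R.
Definition bpow (q p r : R) : R := if (r <= q)%R then (r `^ p)%R else 0%R.

Lemma bal_ge0 q r : (0 <= bal q r)%R. Proof. by rewrite /bal; case: ifP. Qed.
Lemma shl_ge0 q p r : (0 <= shl q p r)%R.
Proof. by rewrite /shl; case: ifP => // _; exact: powR_ge0. Qed.
Lemma bpow_ge0 q p r : (0 <= bpow q p r)%R.
Proof. by rewrite /bpow; case: ifP => // _; exact: powR_ge0. Qed.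

Lemma measurable_bal q : measurable_fun setT (bal q).
Proof. by apply: measurable_fun_ifT; [exact: measurable_fun_ler|exact: measurable_cst|exact: measurable_cst]. Qed.
Lemma measurable_shl q p : measurable_fun setT (shl q p).
Proof.
apply: measurable_fun_ifT; [|exact: measurable_powR|exact: measurable_cst].
by apply: measurable_and; [exact: measurable_fun_ltr|exact: measurable_fun_ler].
Qed.
Lemma measurable_bpow q p : measurable_fun setT (bpow q p).
Proof.
by apply: measurable_fun_ifT; [exact: measurable_fun_ler|exact: measurable_powR|exact: measurable_cst].
Qed.

Let hb0 := bal_ge0. Let hs0 := shl_ge0. Let hp0 := bpow_ge0.
Let mb := measurable_bal. Let ms := measurable_shl. Let mp := measurable_bpow.

(** The volume of the unit ball, kept as an unevaluated constant. *)
Definition kappa : R := fine (rint (bal 1)).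

Lemma rint_bal1 : rint (bal 1) = kappa%:E.
Proof.
rewrite /kappa fineK // ge0_fin_numE ?rint_ge0 //.
apply: (@le_lt_trans _ _ (lebm R d (@cube R d 1))); last exact: lebm_cube.
rewrite -(setIT (@cube R d 1)) -integral_indic //; last exact: measurable_cube.
apply: ge0_le_integral => //.
- by move=> z _; rewrite lee_fin.
- by apply/measurable_EFinP; exact: measurable_radial.
- by apply/measurable_EFinP; apply: measurable_indic; exact: measurable_cube.
- move=> z _; rewrite lee_fin /bal indicE; case: ifPn => // h.
  rewrite mem_set // => i; apply: le_trans h.
  by have := coord_le_edist zero z i; rewrite tnth_nseq sub0r normrN.
Qed.

Lemma kappa_ge0 : (0 <= kappa)%R.
Proof. by rewrite /kappa fine_ge0 // rint_ge0. Qed.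

Lemma rint_bal q : (0 < q)%R -> rint (bal q) = (q ^+ d * kappa)%:E.
Proof.
move=> q0; rewrite EFinM -rint_bal1 -[q in (q ^+ _)%R]invrK -rint_scale ?invr_gt0 //.
apply: eq_rint => r _; rewrite /bal; congr (if _ then _ else _).
by rewrite mulrC ler_pdivrMr // mul1r.
Qed.

Lemma rint_shl0 q : (0 < q < 1)%R -> rint (shl q 0) = (kappa * (1 - q ^+ d))%:E.
Proof.
move=> /andP[q0 q1].
have : rint (shl q 0) + rint (bal q) = rint (bal 1).
  rewrite -rintD //; apply: eq_rint => r _; rewrite /shl /bal powRr0.
  case: (leP r q) => rq /=; first by rewrite (le_trans rq (ltW q1)) add0r.
  by rewrite addr0; case: ifP.
rewrite rint_bal // rint_bal1 => e.
have -> : (kappa * (1 - q ^+ d) = kappa - q ^+ d * kappa)%R by ring.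
by rewrite EFinB -e addeK.
Qed.

(** On the shell exp(-h) < r <= 1 one has |ln r| <= h, so r^p lies between exp(-|p| h) and exp(|p|
    h); the rest is the volume of the shell. *)
Lemma rint_shl_bounds (h p : R) : (0 < h)%R ->
  exists s : R, [/\ rint (shl (expR (- h)) p) = s%:E,
   (kappa * (1 - expR (- (d%:R * h))) * expR (- (`|p| * h)) <= s)%R &
   (s <= kappa * (1 - expR (- (d%:R * h))) * expR (`|p| * h))%R].
Proof.
move=> h0; set q := expR (- h).
have q01 : (0 < q < 1)%R by rewrite expR_gt0 /= expR_lt1 oppr_lt0.
have qd : (q ^+ d = expR (- (d%:R * h)))%R.
  by rewrite /q -expRM_natl mulrN.
have bnd r : (q < r)%R -> (r <= 1)%R ->
   (expR (- (`|p| * h)) <= r `^ p <= expR (`|p| * h))%R.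
  move=> qr r1; have r0 : (0 < r)%R by apply: lt_trans qr; case/andP: q01.
  have lr : (`|ln r| <= h)%R.
    rewrite ler_norml -[X in (X <= _ <= _)%R]expRK -/q.
    rewrite ler_ln ?posrE ?(ltW qr) ?r0 ?expR_gt0 //=.
    by apply: le_trans (ltW h0); rewrite -ln1 ler_ln ?posrE.
  rewrite /powR gt_eqF // !ler_expR -ler_norml normrM.
  exact: ler_wpM2l.
have up : rint (shl q p) <= (expR (`|p| * h))%:E * rint (shl q 0).
  rewrite -rintZ ?expR_ge0 //; apply: le_rint => //.
    by apply: measurable_funM.
  move=> r; rewrite /shl powRr0; case: ifPn => [/andP[a b]|_]; last by rewrite mulr0.
  by rewrite mulr1; case/andP: (bnd _ a b).
have lo : (expR (- (`|p| * h)))%:E * rint (shl q 0) <= rint (shl q p).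
  rewrite -rintZ ?expR_ge0 //; apply: le_rint => //.
  - by apply: measurable_funM.
  - by move=> r; rewrite mulr_ge0 ?expR_ge0.
  move=> r; rewrite /shl powRr0; case: ifPn => [/andP[a b]|_]; last by rewrite mulr0.
  by rewrite mulr1; case/andP: (bnd _ a b).
rewrite rint_shl0 // qd -EFinM in up lo.
have f : rint (shl q p) \is a fin_num.
  by rewrite ge0_fin_numE ?rint_ge0 //; apply: le_lt_trans up _; rewrite ltry.
exists (fine (rint (shl q p))); rewrite fineK //; split => //.
- by rewrite -lee_fin fineK // mulrC.
- by rewrite -lee_fin fineK // mulrC.
Qed.

Lemma powR_scale (q p r : R) : (0 < q)%R -> (0 <= r)%R -> (q `^ p * (q^-1 * r) `^ p = r `^ p)%R.
Proof.
move=> q0 r0; rewrite -powRM ?(ltW q0) //; last by rewrite mulr_ge0 // invr_ge0 ltW.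
by rewrite mulrA mulfV ?mul1r // gt_eqF.
Qed.

(** Let I(e) be the integral over e < r <= 1. A dilation by q gives I(q e) = s + q^(p+d) I(e), and
    I(e) <= I(q e), hence I(e) <= s / (1 - q^(p+d)) for every e. Monotone convergence as e tends to
    0 concludes. *)
Lemma rint_bpow1_fin p : (0 < p + d%:R)%R -> rint (bpow 1 p) < +oo.
Proof.
move=> pd.
(* For p = 0 the integrand is 1 at the origin, a point that no shell contains. For other p the
   convention 0^p = 0 makes the shells converge pointwise everywhere. *)
have [->|p0] := eqVneq p 0%R.
  have -> : rint (bpow 1 0) = rint (bal 1).
    by apply: eq_rint => r _; rewrite /bpow powRr0.
  by rewrite rint_bal1 ltry.
pose q : R := expR (- 1).
have q01 : (0 < q < 1)%R by rewrite expR_gt0 /= expR_lt1 oppr_lt0.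
have [q0 q1] := andP q01.
have [s [sE _ _]] := rint_shl_bounds p ltr01.
have s0 : (0 <= s)%R by rewrite -lee_fin -sE rint_ge0.
have qpd : (q `^ (p + d%:R) < 1)%R.
  by rewrite /q -expRM expR_lt1 mulN1r oppr_lt0.
have qpdE : (q `^ (p + d%:R) = q `^ p * q ^+ d)%R.
  rewrite powRD ?powR_mulrn ?(ltW q0) //.
  by rewrite gt_eqF // implybT.
pose M := (s / (1 - q `^ (p + d%:R)))%R.
have bnd e : (0 < e <= 1)%R -> rint (shl e p) <= M%:E.
  move=> /andP[e0 e1].
  have qe : (q * e <= e)%R by rewrite ger_pMl // ltW.
  have E : rint (shl (q * e) p) = s%:E + (q `^ (p + d%:R))%:E * rint (shl e p).
    rewrite -sE qpdE EFinM -muleA.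
    have -> : (q ^+ d)%:E * rint (shl e p) = rint (fun r => shl e p (q^-1 * r))%R.
      by rewrite rint_scale ?invr_gt0 // invrK.
    have m1 : measurable_fun setT (fun r : R => shl e p (q^-1 * r))%R.
      by apply: (measurableT_comp (ms e p)); exact: measurable_funM.
    rewrite -rintZ ?powR_ge0 // -rintD //; last 2 first.
    - exact: measurable_funM.
    - by move=> r; rewrite mulr_ge0 ?powR_ge0.
    apply: eq_rint => r r0; rewrite /shl.
    have -> : (e < q^-1 * r)%R = (q * e < r)%R by rewrite mulrC ltr_pdivlMr // mulrC.
    have -> : (q^-1 * r <= 1)%R = (r <= q)%R by rewrite mulrC ler_pdivrMr // mul1r.
    case: (leP r q) => rq /=.
      rewrite (le_trans rq (ltW q1)) add0r !andbT; case: ifP => _; last by rewrite mulr0.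
      by rewrite powR_scale.
    rewrite andbF mulr0 addr0.
    have -> // : (q * e < r)%R.
    by apply: le_lt_trans rq; rewrite ger_pMr.
  have ef : rint (shl e p) < +oo.
    have h0 : (0 < - ln e \/ e = 1)%R.
      have [->|e1'] := eqVneq e 1%R; [by right|left].
      by rewrite oppr_gt0 ln_lt0 // e0 lt_neqAle e1' e1.
    case: h0 => [h0|->].
      have [t [tE _ _]] := rint_shl_bounds p h0.
      by rewrite opprK lnK ?posrE // in tE; rewrite tE ltry.
    rewrite (_ : rint _ = rint (fun r => 0 * bal 1 r)%R).
      by rewrite rintZ // mul0e ltry.
    apply: eq_rint => r _; rewrite mul0r /shl; case: ifP => // /andP[a b].
    by have := lt_le_trans a b; rewrite ltxx.
  have le : rint (shl e p) <= rint (shl (q * e) p).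
    apply: le_rint => // r; rewrite /shl; case: ifP => [/andP[a b]|_]; last exact: hs0.
    by rewrite (le_lt_trans qe a) b.
  rewrite E in le.
  have fE : rint (shl e p) = (fine (rint (shl e p)))%:E by rewrite fineK // ge0_fin_numE ?rint_ge0.
  move: le; rewrite fE -EFinM -EFinD !lee_fin /M ler_pdivlMr ?subr_gt0 //.
  by lra.
pose g n (z : T) := (shl n.+1%:R^-1 p (edist zero z))%:E.
have mg n : measurable_fun setT (g n) by apply/measurable_EFinP; exact: measurable_radial.
have g0 n z : setT z -> 0 <= g n z by rewrite lee_fin.
have ndg z : setT z -> nondecreasing_seq (g ^~ z).
  move=> _ m n mn; rewrite lee_fin /shl; case: ifP => [/andP[a b]|_]; last exact: hs0.
  by rewrite (le_lt_trans _ a) ?b // lef_pV2 ?posrE // ler_nat ltnS.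
have lim z : limn (g ^~ z) = (bpow 1 p (edist zero z))%:E.
  apply/cvg_lim => //; rewrite /g /bpow.
  have [e0|e0] := eqVneq (edist zero z) 0%R.
    rewrite e0 ler01 powR0 //; under eq_fun do rewrite /shl ltNge invr_ge0 ler0n /=.
    exact: cvg_cst.
  have {}e0 : (0 < edist zero z)%R by rewrite lt_neqAle eq_sym e0 edist_ge0.
  apply: cvg_near_cst; exists (Num.truncn (edist zero z)^-1) => // n /= hn; rewrite /shl.
  have -> // : (n.+1%:R^-1 < edist zero z)%R.
  rewrite invf_plt ?posrE //; apply: (lt_le_trans (truncnS_gt _)).
  by rewrite ler_nat ltnS.
have cv : \int[lebm R d]_z g n z @[n --> \oo] --> \int[lebm R d]_z limn (g ^~ z).
  exact: cvg_monotone_convergence.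
have -> : rint (bpow 1 p) = \int[lebm R d]_z limn (g ^~ z).
  by apply: eq_integral => z _; rewrite lim.
rewrite -(cvg_lim _ cv) //.
apply: (@le_lt_trans _ _ M%:E); last by rewrite ltry.
apply: lime_le; first by apply/cvg_ex; eexists; exact: cv.
apply: nearW => n; apply: bnd.
by rewrite invr_gt0 ltr0n /= invf_le1 // ler1n.
Qed.

(** Dilation by exp(-h) shows that J (1 - exp(-(p+d) h)) is the integral over a shell, which
    [rint_shl_bounds] encloses on both sides. As h tends to 0, [exp_ratio_le], used in both
    directions, yields (p+d) J = d kappa. *)
Lemma rint_bpow1 p : (0 < p + d%:R)%R ->
  rint (bpow 1 p) = (kappa * d%:R / (p + d%:R))%:E.
Proof.
move=> pd; have f := rint_bpow1_fin pd.
set J := fine (rint (bpow 1 p)).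
have JE : rint (bpow 1 p) = J%:E by rewrite fineK // ge0_fin_numE ?rint_ge0.
have J0 : (0 <= J)%R by rewrite -lee_fin -JE rint_ge0.
have H h : (0 < h)%R -> exists s : R, (J * (1 - expR (- ((p + d%:R) * h))) = s)%R /\
   (kappa * (1 - expR (- (d%:R * h))) * expR (- (`|p| * h)) <= s)%R /\
   (s <= kappa * (1 - expR (- (d%:R * h))) * expR (`|p| * h))%R.
  move=> h0; have [s [sE lo up]] := rint_shl_bounds p h0.
  exists s; split => //; move: sE; set q := expR (- h) => sE.
  have q01 : (0 < q < 1)%R by rewrite expR_gt0 /= expR_lt1 oppr_lt0.
  have [q0 q1] := andP q01.
  have qpdE : (q `^ (p + d%:R) = q `^ p * q ^+ d)%R.
    rewrite powRD ?powR_mulrn ?(ltW q0) //.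
    by rewrite gt_eqF // implybT.
  have E : rint (bpow 1 p) = s%:E + (q `^ (p + d%:R))%:E * rint (bpow 1 p).
    rewrite -sE qpdE EFinM -muleA.
    have -> : (q ^+ d)%:E * rint (bpow 1 p) = rint (fun r => bpow 1 p (q^-1 * r))%R.
      by rewrite rint_scale ?invr_gt0 // invrK.
    have m1 : measurable_fun setT (fun r : R => bpow 1 p (q^-1 * r))%R.
      by apply: (measurableT_comp (mp 1 p)); exact: measurable_funM.
    rewrite -rintZ ?powR_ge0 // -rintD //; last 2 first.
    - exact: measurable_funM.
    - by move=> r; rewrite mulr_ge0 ?powR_ge0.
    apply: eq_rint => r r0; rewrite /shl /bpow.
    have -> : (q^-1 * r <= 1)%R = (r <= q)%R by rewrite mulrC ler_pdivrMr // mul1r.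
    case: (leP r q) => rq /=; first by rewrite (le_trans rq (ltW q1)) add0r powR_scale.
    by rewrite mulr0 addr0.
  move: E; rewrite JE -EFinM -EFinD => -[E].
  have -> : (expR (- ((p + d%:R) * h)) = q `^ (p + d%:R))%R.
    by rewrite /q -expRM; congr expR; ring.
  by lra.
have dR : (0 < d%:R :> R)%R by rewrite ltr0n.
have le1 : ((p + d%:R) * J <= d%:R * kappa)%R.
  apply: (@exp_ratio_le R _ _ _ _ `|p|) => //; first exact: kappa_ge0.
  by move=> h h0; have [s [-> [_ ?]]] := H h h0.
have le2 : (d%:R * kappa <= (p + d%:R) * J)%R.
  apply: (@exp_ratio_le R _ _ _ _ `|p|) => //; first exact: kappa_ge0.
  move=> h h0; have [s [-> [lo _]]] := H h h0.
  rewrite -ler_pdivrMr ?expR_gt0 // -expRN.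
  exact: lo.
rewrite JE; congr EFin; apply/eqP; rewrite eq_sym -subr_eq0.
have pd' : (p + d%:R != 0)%R by rewrite gt_eqF.
rewrite -[X in (_ - X)%R](mulfK pd') -mulrBl mulf_eq0 subr_eq0.
by apply/orP; left; apply/eqP; lra.
Qed.

End Radial.

(** * Neighbourhoods of a compact set *)

Section CompactNeighbourhoods.
Context (R : realType) (d : nat) (W : set (d.-tuple R)).
Hypothesis cW : compact_set_d W.
Local Notation T := (d.-tuple R).

Definition box (e : R) (x : T) : set T := [set y | forall i, `|tnth x i - tnth y i| < e].

Lemma measurable_box e x : measurable (box e x).
Proof.
rewrite (_ : box e x = \bigcap_(i in [set: 'I_d])
   ((fun v : T => tnth v i) @^-1` `](tnth x i - e), (tnth x i + e)[%classic)).
  apply: fin_bigcap_measurable; first exact: finite_finset.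
  move=> i _.
  have mI : measurable (`](tnth x i - e), (tnth x i + e)[%classic : set R) by exact: measurable_itv.
  by have := @measurable_tnth _ R d i measurableT _ mI; rewrite setTI.
apply/seteqP; split => v /=.
  by move=> h i _; have := h i; rewrite /= in_itv /= ltr_norml; lra.
by move=> h i; have := h i Logic.I; rewrite /= in_itv /= ltr_norml; lra.
Qed.

Lemma row_ball (x y : T) (e : R) : 0 < e ->
  ball (row_of_tuple x) e (row_of_tuple y) <-> box e x y.
Proof.
move=> e0; split.
  move=> [_ h] i; have := h ord0 i; rewrite /ball /= !mxE.
  by [].
move=> h; split => // i j; rewrite /ball /= !mxE; exact: h.
Qed.

Lemma finite_net (e : R) : 0 < e -> exists s : seq T,
  (forall x, x \in s -> W x) /\ (forall w, W w -> exists2 x, x \in s & box e x w).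
Proof.
move=> e0; have := cW; rewrite /compact_set_d compact_cover.
move=> /(_ T W (fun x => ball (row_of_tuple x) e)) [].
- by move=> x _; exact: ball_open.
- by move=> _ [w Ww <-]; exists w => //; exact: ballxx.
move=> D' sD cov; exists (finmap.enum_fset D'); split.
  by move=> x xD; have := sD x xD; rewrite inE.
move=> w Ww; have [|x xD bx] := cov (row_of_tuple w); first by exists w.
by exists x => //; apply/row_ball.
Qed.

Lemma compact_limit (y : T) : (forall e, 0 < e -> exists2 w, W w & box e y w) -> W y.
Proof.
move=> H; have cl : closed (@row_of_tuple R d @` W).
  by apply: compact_closed cW; exact: norm_hausdorff.
have [w Ww wy] : (@row_of_tuple R d @` W) (row_of_tuple y).
  apply: cl => B /nbhs_ballP[e /= e0 eB]; have [w Ww bw] := H _ e0.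
  exists (row_of_tuple w); split; first by exists w.
  by apply: eB; apply/row_ball.
suff <- : w = y by [].
by apply: eq_from_tnth => i; have /rowP/(_ i) := wy; rewrite !mxE.
Qed.

(** Finite unions of boxes around finite nets are visibly measurable, and intersecting the first n+1
    of them makes the family decreasing. The intersection is W because a compact set contains its
    limit points. *)
Lemma compact_neighbourhoods : exists V : nat -> set T,
  [/\ forall n, measurable (V n),
      (lebm R d (V 0%N) < +oo)%E,
      {homo V : n m / (n <= m)%N >-> (m <= n)%O},
      \bigcap_n V n = W &
      forall n x y, W x -> edist x y < n.+1%:R^-1 -> V n y].
Proof.
have e0 k : 0 < k.+1%:R^-1 :> R by rewrite invr_gt0.
have [net netP] := choice (fun k => finite_net (e0 k)).
(* The radius is doubled: one 1/(k+1) reaches from the net to a point of W, the other from there to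
   the neighbouring point. *)
pose U k := \bigcup_(x in [set` net k]) box (2 * k.+1%:R^-1) x.
have mU k : measurable (U k).
  by apply: fin_bigcup_measurable; [exact: finite_seq|move=> x _; exact: measurable_box].
have WU n k x y : W x -> edist x y < n.+1%:R^-1 -> (k <= n)%N -> U k y.
  move=> Wx xy kn; have [z zs zx] := (netP k).2 x Wx; exists z => // i.
  have h1 : `|tnth x i - tnth y i| < k.+1%:R^-1.
    apply: le_lt_trans (coord_le_edist x y i) _; apply: lt_le_trans xy _.
    by rewrite lef_pV2 ?posrE // ler_nat ltnS.
  have := zx i; rewrite /= => h2.
  rewrite (_ : tnth z i - tnth y i = (tnth z i - tnth x i) + (tnth x i - tnth y i)); last by ring.
  by apply: le_lt_trans (ler_normD _ _) _; rewrite mulr2n mulrDl mul1r ltrD.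
exists (fun n => \bigcap_(k in `I_n.+1) U k); split.
- by move=> n; apply: bigcap_measurableType => k _; exact: mU.
(* A crude bound on all coordinates of all points of the first net; the boxes of level 0 have radius
   2. *)
- pose r : R := \sum_(x <- net 0%N) \sum_(i < d) `|tnth x i|.
  apply: (@le_lt_trans _ _ (lebm R d (@cube R d (r + 2)))); last exact: lebm_cube.
  apply: le_measure; rewrite ?inE.
  + by apply: bigcap_measurableType => k _; exact: mU.
  + exact: measurable_cube.
  move=> y /(_ 0%N) [] // x /= xs xy i; have := xy i; rewrite invr1 mulr1 => h.
  have : `|tnth x i| <= r.
    rewrite /r (big_rem x xs) /= (bigD1 i) //= -!addrA lerDl addr_ge0 //.
      by apply: sumr_ge0.
    by do 2 (apply: sumr_ge0 => ? _).
  have := ler_normB (tnth x i) (tnth x i - tnth y i).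
  by rewrite opprB addrCA subrr addr0; lra.
- by move=> n m nm; apply/subsetPset => y h k kn; apply: h; apply: leq_trans kn _.
- apply/seteqP; split => y.
    move=> h; apply: compact_limit => e e1.
    pose k := Num.truncn (2 * e^-1).
    have [x xs xy] : U k y by apply: (h k Logic.I) => /=.
    exists x; first exact: (netP k).1.
    move=> i; have := xy i; rewrite distrC => /lt_trans; apply.
    rewrite ltr_pdivrMr // mulrC -ltr_pdivrMr //.
    exact: truncnS_gt.
  move=> Wy n _ k kn; apply: (WU n k y y) => //.
  by rewrite /Defs.edist big1 ?sqrtr0 // => i _; rewrite subrr expr0n.
- by move=> n x y Wx xy k kn; exact: (WU n k x y).
Qed.

End CompactNeighbourhoods.

(** * The intensity measure: a scaled restriction of a measure *)

Section ScaledRestriction.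
Context (R : realType) (dT : measure_display) (T : measurableType dT)
  (m : {measure set T -> \bar R}) (W : set T) (mW : measurable W) (t : {nonneg R}).
Hypothesis finW : (m W < +oo)%E.
Local Open Scope ereal_scope.

(** The proofs [mW] and [finW] are carried by the term so that its measure and sigma-finiteness
    instances can be inferred. *)
Definition srestr (mW : measurable W) (finW : m W < +oo) : set T -> \bar R :=
  mscale t (mrestr m mW).

Local Notation mu := (srestr mW finW).

HB.instance Definition _ := Measure.copy mu (mscale t (mrestr m mW)).

Lemma srestrE A : mu A = t%:num%:E * m (A `&` W).
Proof. by []. Qed.

Lemma srestr_fin : mu setT < +oo.
Proof. by rewrite srestrE setTI lte_mul_pinfty // lee_fin. Qed.

Lemma srestr_sigma_finite : sigma_finite setT mu.
Proof.
exists (fun=> setT); first by rewrite bigcup_const.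
by move=> _; split => //; exact: srestr_fin.
Qed.

HB.instance Definition _ := Measure_isSigmaFinite.Build _ _ _ mu srestr_sigma_finite.

Lemma integral_srestr (f : T -> \bar R) : measurable_fun setT f -> (forall x, 0 <= f x) ->
  \int[mu]_x f x = t%:num%:E * \int[m]_(x in W) f x.
Proof.
move=> mf f0.
transitivity (t%:num%:E * \int[mrestr m mW]_x f x).
  exact: ge0_integral_mscale.
congr (_ * _); rewrite -(setUv W) ge0_integral_setU //; last 3 first.
- exact: measurableC.
- by rewrite setUv.
- by apply/disj_setPS; rewrite setICr.
rewrite [X in _ + X = _](_ : _ = 0) ?adde0; last first.
  apply: null_set_integral => //; first exact: measurableC.
  - exact: measurable_funTS.
  - by rewrite /= /mrestr setICl measure0.
apply: eq_measure_integral => A mA AW; rewrite /= /mrestr.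
by congr (m _); exact: setIidl.
Qed.

End ScaledRestriction.

(** * The length power functional as a sum over pairs *)

Section LengthPower.
Context (R : realType) (d : nat).
Local Notation T := (d.-tuple R).

(** Distinct indices and removal by [rem] agree even if points repeat: either way the sum is the
    full double sum minus its diagonal. *)
Lemma length_power_dsum (delta tau : R) (s : seq T) :
  length_power delta tau s = 2^-1 * dsum (fun x y => bpow delta tau (edist x y)) s.
Proof.
congr (_ * _); rewrite dsum_diag -sumrB (big_nth [tuple of nseq d 0]) big_mkord.
apply: eq_bigr => i _; rewrite (big_nth [tuple of nseq d 0]) big_mkord.
rewrite [X in _ = X - _](bigD1 i) //= addrAC subrr add0r.
by apply: eq_bigl => j; rewrite eq_sym.
Qed.

End LengthPower.

(** * The normalised kernels *)

Lemma integral_indicM (R : realType) (dT : measure_display) (T : measurableType dT)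
  (m : {measure set T -> \bar R}) (D : set T) (g : T -> R) :
  (\int[m]_(y in D) (g y)%:E = \int[m]_y (g y * \1_D y)%:E)%E.
Proof.
rewrite integral_mkcond; apply: eq_integral => y _; rewrite patchE indicE.
by case: ifP => _; rewrite ?mulr1 ?mulr0.
Qed.

Section KernelEstimates.
Context (R : realType) (d : nat).
Hypothesis d0 : (0 < d)%N.
Local Notation T := (d.-tuple R).
Local Notation leb := (lebm R d).
Local Open Scope ereal_scope.

Lemma rint_bpow delta p : (0 < delta)%R -> (0 < p + d%:R)%R ->
  rint d (bpow delta p) = (kappa R d * d%:R / (p + d%:R) * (delta `^ p * delta ^+ d))%:E.
Proof.
move=> e0 pd; rewrite [RHS]EFinM -(rint_bpow1 d0 pd) muleC (EFinM (delta `^ p)) -muleA.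
rewrite -[delta in (delta ^+ d)%R]invrK -rint_scale ?invr_gt0 //; last 2 first.
- exact: measurable_bpow.
- exact: bpow_ge0.
rewrite -rintZ ?powR_ge0 //; last 2 first.
- by apply: (measurableT_comp (measurable_bpow 1 p)); exact: measurable_funM.
- by move=> r; exact: bpow_ge0.
apply: eq_rint => r r0; rewrite /bpow.
have -> : (delta^-1 * r <= 1)%R = (r <= delta)%R by rewrite mulrC ler_pdivrMr // mul1r.
by case: ifP => _; [rewrite powR_scale|rewrite mulr0].
Qed.

Variables (W V : set T) (mW : measurable W) (mV : measurable V) (finW : leb W < +oo).
Variables (t : {nonneg R}) (delta : R).
Hypothesis delta0 : (0 < delta)%R.
Hypothesis WV : forall x y, W x -> (edist x y <= delta)%R -> V y.
Local Notation mu := (srestr t mW finW).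

Definition ker (c tau : R) (x y : T) : R := (c * bpow delta tau (edist x y))%R.

Section OneKernel.
Variables c tau : R.
Hypothesis c0 : (0 <= c)%R.
Local Notation f := (ker c tau).

Lemma ker_ge0 x y : (0 <= f x y)%R.
Proof. by rewrite mulr_ge0 // bpow_ge0. Qed.

Lemma kerC x y : f x y = f y x.
Proof. by rewrite /ker edistC. Qed.

Lemma measurable_ker : measurable_fun setT (fun u : T * T => f u.1 u.2).
Proof.
apply: measurable_funM => //.
exact: (measurableT_comp (measurable_bpow _ _) (@measurable_edist R d)).
Qed.

Lemma measurable_kerr x : measurable_fun setT (f x).
Proof.
apply: measurable_funM => //.
exact: (measurableT_comp (measurable_bpow _ _) (@measurable_edistr R d x)).
Qed.

Lemma integral_ker x : (0 < tau + d%:R)%R ->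
  \int[leb]_y (f x y)%:E =
  (c * (kappa R d * d%:R / (tau + d%:R) * (delta `^ tau * delta ^+ d)))%:E.
Proof.
move=> td; rewrite integral_EFinZ //; last 2 first.
- exact: (measurableT_comp (measurable_bpow _ _) (@measurable_edistr R d x)).
- by move=> y; exact: bpow_ge0.
rewrite rint_translate //; last 2 first.
- exact: measurable_bpow.
- exact: bpow_ge0.
by rewrite rint_bpow // EFinM.
Qed.

(** [phi] and [beta] are t times the integrals of the kernel over W and over its complement. For x
    in W the latter only sees [V] minus W; exchanging the integrals and enlarging the x-domain to
    the whole space leaves K / t for each such y, while [beta] and [mu] each bring a factor t. *)
Lemma ker_deficit (K : R) : (0 < tau + d%:R)%R ->
  (K = t%:num * (c * (kappa R d * d%:R / (tau + d%:R) * (delta `^ tau * delta ^+ d))))%R ->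
  exists phi beta : T -> R,
  [/\ forall x, kint mu f x = (phi x)%:E, forall x, (phi x + beta x = K)%R,
      forall x, (0 <= phi x)%R, forall x, (0 <= beta x)%R & measurable_fun setT beta /\
      \int[mu]_x (beta x)%:E <= (t%:num * K)%:E * leb (V `\` W)].
Proof.
move=> td KE.
have f0 := ker_ge0; have mf := measurable_ker; have mfr := measurable_kerr.
have mfE x : measurable_fun setT (fun y => (f x y)%:E) by exact/measurable_EFinP.
have t0 : (0 <= t%:num)%R by [].
have int x D : measurable D -> \int[leb]_(y in D) (f x y)%:E <= \int[leb]_y (f x y)%:E.
  move=> mD; apply: ge0_subset_integral => //.
  by move=> y _; rewrite lee_fin.
have intf x D : measurable D -> \int[leb]_(y in D) (f x y)%:E =
    (fine (\int[leb]_(y in D) (f x y)%:E))%:E.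
  move=> mD; rewrite fineK // ge0_fin_numE.
    by apply: le_lt_trans (int x D mD) _; rewrite integral_ker // ltry.
  by apply: integral_ge0 => y _; rewrite lee_fin.
have mWC : measurable (~` W) by exact: measurableC.
pose A x := fine (\int[leb]_(y in W) (f x y)%:E).
pose B x := fine (\int[leb]_(y in ~` W) (f x y)%:E).
have A0 x : (0 <= A x)%R by apply/fine_ge0/integral_ge0 => y _; rewrite lee_fin.
have B0 x : (0 <= B x)%R by apply/fine_ge0/integral_ge0 => y _; rewrite lee_fin.
have AB x : (t%:num * A x + t%:num * B x = K)%R.
  rewrite KE -mulrDr; congr (_ * _)%R.
  have : ((A x)%:E + (B x)%:E) = \int[leb]_y (f x y)%:E.
    rewrite -(setUv W) ge0_integral_setU //; first by rewrite -!intf.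
    - by rewrite setUv.
    - by move=> y _; rewrite lee_fin.
    - by apply/disj_setPS; rewrite setICr.
  by rewrite integral_ker // -EFinD => -[].
have mB : measurable_fun setT B.
  apply/measurable_EFinP.
  have m1 : measurable_fun setT (fun u : T * T => (f u.1 u.2 * \1_(~` W) u.2)%:E).
    apply/measurable_EFinP; apply: measurable_funM => //.
    by apply: (measurableT_comp (measurable_indic _)).
  have := @measurable_fun_fubini_tonelli_F _ _ _ _ _ leb _ m1.
  rewrite (_ : fubini_F _ _ = EFin \o B).
    by apply => u; rewrite lee_fin mulr_ge0.
  by apply/funext => x; rewrite [RHS]/= /B -(intf x _ mWC) integral_indicM.
exists (fun x => t%:num * A x)%R, (fun x => t%:num * B x)%R; split => //.
- by move=> x; rewrite /kint integral_srestr //; [rewrite intf // EFinM|move=> y; rewrite lee_fin].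
- by move=> x; rewrite mulr_ge0.
- by move=> x; rewrite mulr_ge0.
split; first exact: measurable_funM.
rewrite integral_EFinZ // EFinM -muleA lee_wpmul2l ?lee_fin //.
rewrite integral_srestr; [|exact/measurable_EFinP|by move=> x; rewrite lee_fin].
have [->|tn0] := eqVneq t%:num 0%R.
  by rewrite mul0e mule_ge0 // lee_fin -(AB point) addr_ge0 // mulr_ge0.
have tp : (0 < t%:num)%R by rewrite lt_neqAle eq_sym tn0.
pose D := V `\` W.
have mD : measurable D by exact: measurableD.
have -> : K%:E = t%:num%:E * (K / t%:num)%:E by rewrite -EFinM mulrC divfK.
rewrite -muleA lee_wpmul2l ?lee_fin //.
pose g (u : T * T) := (f u.1 u.2 * \1_D u.2)%:E.
have g0 u : 0 <= g u by rewrite lee_fin mulr_ge0 // f0.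
have mg : measurable_fun setT g.
  apply/measurable_EFinP; apply: measurable_funM => //.
  by apply: (measurableT_comp (measurable_indic mD)).
apply: (@le_trans _ _ (\int[leb]_x \int[leb]_y g (x, y))).
  apply: (@le_trans _ _ (\int[leb]_(x in W) \int[leb]_y g (x, y))).
    apply: ge0_le_integral => //.
    - by move=> x _; rewrite lee_fin.
    - by apply/measurable_EFinP; exact: measurable_funTS.
    - apply: measurable_funTS.
      exact: (@measurable_fun_fubini_tonelli_F _ _ _ _ _ leb _ mg).
    - move=> x Wx; rewrite -intf // integral_indicM; apply: ge0_le_integral => //.
      + by move=> y _; rewrite lee_fin mulr_ge0 // f0.
      + by apply/measurable_EFinP; apply: measurable_funM => //; exact: measurable_indic.
      + exact: (measurableT_comp mg (measurable_fun_pair (measurable_cst x) (@measurable_id _ _ setT))).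
      + move=> y _; rewrite lee_fin /=.
        (* A nonzero kernel value forces [edist x y <= delta], and then y is in [V] because x is in
           W. *)
        have [fz|fz] := eqVneq (f x y) 0%R; first by rewrite fz !mul0r.
        rewrite ler_wpM2l ?f0 // !indicE ler_nat.
        case: (boolP (y \in ~` W)) => // yW; rewrite mem_set //; split; last by rewrite inE in yW.
        apply: (WV Wx); rewrite leNgt; apply/negP => lt.
        by move: fz; rewrite /ker /bpow leNgt lt /= mulr0 eqxx.
  apply: ge0_subset_integral => //.
  - exact: (@measurable_fun_fubini_tonelli_F _ _ _ _ _ leb _ mg).
  - by move=> x _; apply: integral_ge0 => y _.
rewrite (fubini_tonelli g) //.
rewrite (_ : leb D = \int[leb]_y (\1_D y)%:E); last by rewrite integral_indic // setIT.
rewrite -ge0_integralZl //; last by rewrite lee_fin divr_ge0 // -(AB point) addr_ge0 // mulr_ge0.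
rewrite le_eqVlt; apply/orP; left; apply/eqP; apply: eq_integral => y _.
transitivity (\int[leb]_x ((f y x)%:E * (\1_D y)%:E)).
  by apply: eq_integral => x _; rewrite /g /= EFinM kerC.
rewrite ge0_integralZr //; last by move=> x _; rewrite lee_fin.
rewrite integral_ker //; congr (_%:E * _).
by rewrite KE [RHS]mulrC mulKf.
by apply/measurable_EFinP; exact: measurable_indic.
Qed.

(** The squared kernel is again a truncated power, of exponent 2 tau, so the radial integral applies
    as soon as 2 tau + d > 0. *)
Lemma ker_sqr : (0 < 2 * tau + d%:R)%R ->
  \int[mu]_x \int[mu]_y (f x y * f x y)%:E <=
  (t%:num ^+ 2 * fine (leb W) * (c ^+ 2 * (kappa R d * d%:R / (2 * tau + d%:R) *
     (delta `^ (2 * tau) * delta ^+ d))))%:E.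
Proof.
move=> td.
have c20 : (0 <= c ^+ 2)%R by exact: sqr_ge0.
pose h (x y : T) := (c ^+ 2 * bpow delta (2 * tau) (edist x y))%R.
have fh x y : (f x y * f x y = h x y)%R.
  rewrite /ker /h mulrACA -expr2; congr (_ * _)%R; rewrite /bpow.
  case: ifP => _; last by rewrite mulr0.
  by rewrite [(2 * tau)%R]mulrC powRrM powR_mulrn ?powR_ge0 // expr2.
have h0 x y : (0 <= h x y)%R by rewrite mulr_ge0 // bpow_ge0.
have mh x : measurable_fun setT (h x).
  apply: measurable_funM => //.
  exact: (measurableT_comp (measurable_bpow _ _) (@measurable_edistr R d x)).
have hi x : \int[leb]_y (h x y)%:E = (c ^+ 2 * (kappa R d * d%:R / (2 * tau + d%:R) *
     (delta `^ (2 * tau) * delta ^+ d)))%:E.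
  rewrite integral_EFinZ //; last 2 first.
  - exact: (measurableT_comp (measurable_bpow _ _) (@measurable_edistr R d x)).
  - by move=> y; exact: bpow_ge0.
  rewrite rint_translate //; last 2 first.
  - exact: measurable_bpow.
  - exact: bpow_ge0.
  by rewrite rint_bpow // EFinM.
set C := (c ^+ 2 * _)%R in hi *.
have C0 : (0 <= C)%R by rewrite -lee_fin -(hi point); apply: integral_ge0 => y _; rewrite lee_fin.
have inner x : \int[mu]_y (f x y * f x y)%:E <= (t%:num * C)%:E.
  under eq_integral do rewrite fh.
  rewrite integral_srestr //; [|exact/measurable_EFinP|by move=> y; rewrite lee_fin].
  rewrite EFinM lee_wpmul2l ?lee_fin // -(hi x).
  apply: ge0_subset_integral => //; first exact/measurable_EFinP.
  by move=> y _; rewrite lee_fin.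
apply: (@le_trans _ _ (\int[mu]_x (cst (t%:num * C)%:E x))).
  apply: ge0_le_integral => //.
  - by move=> x _; apply: integral_ge0 => y _; rewrite lee_fin fh.
  - have m2 : measurable_fun setT (fun u : T * T => (f u.1 u.2 * f u.1 u.2)%:E).
      by apply/measurable_EFinP; apply: measurable_funM; exact: measurable_ker.
    apply: (@measurable_fun_fubini_tonelli_F _ _ _ _ _ mu _ m2) => u.
    by rewrite lee_fin fh.
apply: (@le_trans _ _ ((t%:num * C)%:E * mu setT)); first by rewrite integral_cst.
have wE : leb W = (fine (leb W))%:E by rewrite fineK // ge0_fin_numE.
have -> : mu setT = (t%:num * fine (leb W))%:E.
  by rewrite (srestrE mW t finW) setTI EFinM; congr (_ * _); exact: wE.
by rewrite -EFinM lee_fin; rewrite le_eqVlt; apply/orP; left; apply/eqP; ring.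
Qed.

End OneKernel.
End KernelEstimates.

(** * Deviation bound and convergence *)

Lemma dsumZ (R : realType) (dT : measure_display) (T : measurableType dT)
  (c : R) (k : T -> T -> R) s : dsum (fun x y => c * k x y) s = c * dsum k s.
Proof.
rewrite /dsum mulr_sumr; apply: eq_bigr => x _; by rewrite mulr_sumr.
Qed.

Section Normalisation.
Context (R : realType) (d : nat) (t delta : R).
Hypothesis t0 : 0 < t.
Hypothesis delta0 : 0 < delta.

(** The normalisation at tau = 0; [nrmE] extracts delta^tau in general. *)
Definition nrm0 : R := Num.max (t * delta `^ (d%:R / 2)) (t `^ (3 / 2) * delta ^+ d).

Lemma nrm0_gt0 : 0 < nrm0.
Proof. by rewrite lt_max mulr_gt0 // powR_gt0. Qed.

Lemma nrmE (tau : R) :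
  Num.max (t * delta `^ (tau + d%:R / 2)) (t `^ (3 / 2) * delta `^ (tau + d%:R))
  = delta `^ tau * nrm0.
Proof.
have dn : delta != 0 by rewrite gt_eqF.
rewrite !powRD ?dn ?implybT // powR_mulrn ?(ltW delta0) //.
by rewrite maxr_pMr ?powR_ge0 // !(mulrCA (delta `^ tau)).
Qed.

(** Only the second entry of the maximum is kept; this inequality controls both terms of
    [deviation_bound]. *)
Lemma nrm0_sqr : t ^+ 3 * (delta ^+ d) ^+ 2 <= nrm0 ^+ 2.
Proof.
have -> : t ^+ 3 * (delta ^+ d) ^+ 2 = (t `^ (3 / 2) * delta ^+ d) ^+ 2.
  rewrite [RHS]exprMn -(powR_mulrn 2 (powR_ge0 t (3 / 2))) -powRrM.
  by rewrite divfK ?pnatr_eq0 // powR_mulrn // ltW.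
rewrite ler_pXn2r ?nnegrE ?(ltW nrm0_gt0) //; last first.
  by rewrite mulr_ge0 ?powR_ge0 // exprn_ge0 // ltW.
by rewrite le_max lexx orbT.
Qed.

End Normalisation.

Section FixedIntensity.
Context (R : realType) (d : nat) (W V : set (d.-tuple R))
  (dO : measure_display) (O : measurableType dO) (P : probability O R)
  (X : O -> seq (d.-tuple R)) (t delta : R).
Hypothesis d0 : (0 < d)%N.
Hypothesis mW : measurable W.
Hypothesis mV : measurable V.
Hypothesis finW : (lebm R d W < +oo)%E.
Hypothesis t0 : 0 < t.
Hypothesis delta0 : 0 < delta.
Hypothesis WV : forall x y, W x -> edist x y <= delta -> V y.
Hypothesis HX : is_poisson_pp P X (intensity W t).

Let tn : {nonneg R} := NngNum (ltW t0).
Let mu := srestr tn mW finW.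
Let M := nrm0 d t delta.
Let D : R := d%:R.
Let kap := kappa R d.

(* The factor 1/2 is there because [dsum] visits every pair twice. *)
Definition coef (tau : R) : R := (tau + d%:R) / (delta `^ tau * nrm0 d t delta) / 2.

Let M0 : 0 < M. Proof. exact: nrm0_gt0. Qed.

Lemma poisson_counts (k : nat) (B : 'I_k -> set (d.-tuple R)) (n : 'I_k -> nat) :
  (forall i, measurable (B i)) ->
  (forall i j, i != j -> B i `&` B j = set0) ->
  P (\bigcap_(i in [set: 'I_k]) [set w | count (fun x => x \in B i) (X w) = n i])
  = (\prod_(i < k) poissonp (fine (mu (B i))) (n i))%:E.
Proof.
move=> mB dB; have [_ /(_ k B n mB dB)] := HX; rewrite /npoints => ->.
congr EFin; apply: eq_bigr => i _; congr poissonp.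
by rewrite /intensity lebmE /mu srestrE fineZl.
Qed.

Lemma Ltilde_dsum (tau : R) w : 0 < tau + d%:R ->
  (tau + d%:R) * Ltilde P X t delta tau w =
  dsum (ker delta (coef tau) tau) (X w)
  - fine (\int[P]_w (dsum (ker delta (coef tau) tau) (X w))%:E)%E.
Proof.
move=> td.
have k0 (x y : d.-tuple R) : 0 <= bpow delta tau (edist x y) by exact: bpow_ge0.
have mk : measurable_fun setT (fun u : d.-tuple R * d.-tuple R => bpow delta tau (edist u.1 u.2)).
  exact: (measurableT_comp (measurable_bpow _ _) (@measurable_edist R d)).
have [mL _] := dsum_mean (srestr_fin mW tn finW) HX.1 poisson_counts k0 mk.
have mL' : measurable_fun setT (fun w => dsum (fun x y => bpow delta tau (edist x y)) (X w)).
  exact/measurable_EFinP.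
have L0 w' : 0 <= dsum (fun x y => bpow delta tau (edist x y)) (X w').
  by do 2 (apply: sumr_ge0 => ? _); exact: bpow_ge0.
have nz : 0 < delta `^ tau * nrm0 d t delta by rewrite mulr_gt0 // powR_gt0.
have c0 : 0 < coef tau by rewrite /coef !divr_gt0.
rewrite /Ltilde nrmE // /expect.
have DK s : dsum (ker delta (coef tau) tau) s
    = coef tau * dsum (fun x y => bpow delta tau (edist x y)) s by exact: dsumZ.
have -> : (\int[P]_w (length_power delta tau (X w))%:E =
    (2^-1)%:E * \int[P]_w (dsum (fun x y => bpow delta tau (edist x y)) (X w))%:E)%E.
  rewrite -integral_EFinZ ?invr_ge0 //.
  by apply: eq_integral => w' _; rewrite length_power_dsum.
have -> : (\int[P]_w (dsum (ker delta (coef tau) tau) (X w))%:E =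
    (coef tau)%:E * \int[P]_w (dsum (fun x y => bpow delta tau (edist x y)) (X w))%:E)%E.
  rewrite -integral_EFinZ ?(ltW c0) //.
  by apply: eq_integral => w' _; rewrite DK.
rewrite !fineZl ?invr_gt0 // DK length_power_dsum /coef.
have n1 : nrm0 d t delta != 0 by rewrite gt_eqF //; exact: M0.
have n2 : delta `^ tau != 0 by rewrite gt_eqF // powR_gt0.
by field; rewrite ?n1 ?n2.
Qed.

(** What remains of the bound of [ker_sqr], at [coef tau], once t^2 delta^d / nrm0^2 is taken
    out. *)
Definition varc (tau : R) : R :=
  (tau + d%:R) ^+ 2 * fine (lebm R d W) * kappa R d * d%:R / (4 * (2 * tau + d%:R)).

Lemma deviation_bound (tau1 tau2 eps : R) : - (d%:R / 2) < tau1 -> - (d%:R / 2) < tau2 ->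
  0 < eps ->
  ((eps ^+ 2)%:E * P [set w | (eps < `|(tau1 + d%:R) * Ltilde P X t delta tau1 w
                        - (tau2 + d%:R) * Ltilde P X t delta tau2 w|)%R]
  <= (2 * (kappa R d * d%:R) ^+ 2)%:E * lebm R d (V `\` W)
     + (2 * (varc tau1 + varc tau2) / (t * delta ^+ d))%:E)%E.
Proof.
move=> h1 h2 eps0.
have dR : 0 < D by rewrite ltr0n.
have td (tau : R) : - (d%:R / 2) < tau -> 0 < tau + d%:R by rewrite -/D; lra.
have td2 (tau : R) : - (d%:R / 2) < tau -> 0 < 2 * tau + d%:R by rewrite -/D; lra.
have E0 : 0 < delta ^+ d by rewrite exprn_gt0.
have dt0 (tau : R) : 0 < delta `^ tau by rewrite powR_gt0.
have c0 (tau : R) : - (d%:R / 2) < tau -> 0 <= coef tau.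
  by move=> h; rewrite /coef !divr_ge0 ?mulr_ge0 ?(ltW (td _ h)) ?(ltW M0) // ltW.
(* The common value of t times the full kernel integral: tau + d and delta^tau in [coef] cancel
   those of the radial integral. *)
pose K : R := t * (kap * D * delta ^+ d) / (2 * M).
have KE (tau : R) : - (d%:R / 2) < tau ->
    K = tn%:num * (coef tau * (kap * D / (tau + d%:R) * (delta `^ tau * delta ^+ d))).
  move=> h; rewrite /K /coef /= -/M -/D; field.
  by rewrite (gt_eqF M0) (gt_eqF (dt0 _)) (gt_eqF (td _ h)).
have kap0 : 0 <= kap by exact: kappa_ge0.
have K0 : 0 <= K by rewrite /K divr_ge0 ?mulr_ge0 // ltW.
have [phi1 [beta1 [p1 pb1 p10 b10 [mb1 ib1]]]] :=
  ker_deficit d0 mW mV finW (t := tn) delta0 WV (c0 _ h1) (td _ h1) (KE _ h1).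
have [phi2 [beta2 [p2 pb2 p20 b20 [mb2 ib2]]]] :=
  ker_deficit d0 mW mV finW (t := tn) delta0 WV (c0 _ h2) (td _ h2) (KE _ h2).
have s1 := ker_sqr d0 mW finW tn delta0 (coef tau1) (td2 _ h1).
have s2 := ker_sqr d0 mW finW tn delta0 (coef tau2) (td2 _ h2).
have pK1 x : phi1 x <= K by have := pb1 x; have := b10 x; lra.
have pK2 x : phi2 x <= K by have := pb2 x; have := b20 x; lra.
have Ch := dsum_chebyshev (srestr_fin mW tn finW) HX.1 poisson_counts
  (ker_ge0 delta tau1 (c0 _ h1)) (ker_ge0 delta tau2 (c0 _ h2))
  (kerC delta _ tau1) (kerC delta _ tau2)
  (measurable_ker delta _ tau1) (measurable_ker delta _ tau2)
  p1 p2 pK1 pK2 (le_lt_trans s1 (ltry _)) (le_lt_trans s2 (ltry _)) eps0.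
set S := [set w | _].
have SE : S = [set w | eps < `|dsum (ker delta (coef tau1) tau1) (X w)
   - fine (\int[P]_w (dsum (ker delta (coef tau1) tau1) (X w))%:E)%E
   - (dsum (ker delta (coef tau2) tau2) (X w)
   - fine (\int[P]_w (dsum (ker delta (coef tau2) tau2) (X w))%:E)%E)|].
  by apply/seteqP; split => w; rewrite /S /= !Ltilde_dsum ?td.
rewrite SE; apply: le_trans Ch _.
set v := lebm R d (V `\` W) in ib1 ib2 *.
have v0 : (0 <= v)%E by exact: measure_ge0.
have M2 : t ^+ 3 * (delta ^+ d) ^+ 2 <= M ^+ 2 by exact: nrm0_sqr.
have M20 : 0 < M ^+ 2 by rewrite exprn_gt0.
apply: leeD.
- have mbb : measurable_fun setT (fun x => beta1 x + beta2 x) by exact: measurable_funD.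
  (* phi1 - phi2 = beta2 - beta1, and both betas lie in [0, K], so the square is at most K (beta1 +
     beta2). *)
  have le1 : (\int[mu]_x ((phi1 x - phi2 x) ^+ 2)%:E <=
      \int[mu]_x (K * (beta1 x + beta2 x))%:E)%E.
    have e x : phi1 x - phi2 x = beta2 x - beta1 x.
      by have := pb1 x; have := pb2 x; lra.
    apply: ge0_le_integral => //.
    + by move=> x _; rewrite lee_fin sqr_ge0.
    + apply/measurable_EFinP; under eq_fun do rewrite e.
      by apply: measurable_funX; exact: measurable_funB.
    + by apply/measurable_EFinP; exact: measurable_funM.
    + move=> x _; rewrite lee_fin e.
      have := pb1 x; have := pb2 x; have := b10 x; have := b20 x.
      by have := p10 x; have := p20 x; nra.
  have le2 : (\int[mu]_x ((phi1 x - phi2 x) ^+ 2)%:E <= (K * (2 * (t * K)))%:E * v)%E.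
    apply: le_trans le1 _; rewrite integral_EFinZ //; last first.
      by move=> x; rewrite addr_ge0.
    rewrite integral_EFinD // (EFinM K (2 * (t * K))) -muleA lee_wpmul2l ?lee_fin //.
    have -> : 2 * (t * K) = t * K + t * K by ring.
    have tK0 : 0 <= t * K by apply: mulr_ge0; [exact: ltW|exact: K0].
    rewrite EFinD ge0_muleDl ?lee_fin //.
    exact: leeD.
  have four : (0 <= 4%:E :> \bar R)%E by rewrite lee_fin.
  apply: (le_trans (lee_wpmul2l four le2)).
  rewrite muleA -EFinM lee_wpmul2r // lee_fin.
  (* The last quotient is at most 1 by [nrm0_sqr], which leaves 2 (kappa d)^2. *)
  have -> : 4 * (K * (2 * (t * K))) =
      2 * (kap * D) ^+ 2 * (t ^+ 3 * (delta ^+ d) ^+ 2 / M ^+ 2).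
    by rewrite /K; field; rewrite gt_eqF.
  apply: ler_piMr; first by rewrite mulr_ge0 // sqr_ge0.
  by rewrite ler_pdivrMr // mul1r.
(* By [nrm0_sqr], t^2 delta^d / M^2 is at most 1 / (t delta^d). *)
- have q (tau : R) : - (d%:R / 2) < tau ->
    ((tn%:num ^+ 2 * fine (lebm R d W) * (coef tau ^+ 2 * (kap * D / (2 * tau + D) *
      (delta `^ (2 * tau) * delta ^+ d))))%:E <= (varc tau / (t * delta ^+ d))%:E)%E.
    rewrite lee_fin.
    move=> h; have td2h := td2 _ h.
    have -> : delta `^ (2 * tau) = (delta `^ tau) ^+ 2.
      by rewrite [2 * tau]mulrC powRrM powR_mulrn ?powR_ge0.
    have -> : tn%:num ^+ 2 * fine (lebm R d W) * (coef tau ^+ 2 * (kap * D / (2 * tau + D) *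
      ((delta `^ tau) ^+ 2 * delta ^+ d))) = varc tau * (t ^+ 2 * delta ^+ d / M ^+ 2).
      rewrite /coef /varc /= -/M -/D -/kap; field.
      by rewrite (gt_eqF M0) (gt_eqF (dt0 _)) (gt_eqF td2h).
    apply: ler_wpM2l.
      apply: divr_ge0; last by apply: mulr_ge0 => //; exact: ltW.
      apply: mulr_ge0 => //; apply: mulr_ge0; last exact: kap0.
      by apply: mulr_ge0; [exact: sqr_ge0|exact: fine_ge0].
    rewrite ler_pdivrMr // [leRHS]mulrC ler_pdivlMr ?mulr_gt0 //.
    by apply: le_trans M2; rewrite le_eqVlt; apply/orP; left; apply/eqP; ring.
  have {}s1 := le_trans s1 (q _ h1); have {}s2 := le_trans s2 (q _ h2).
  apply: (@le_trans _ _ (2%:E * ((varc tau1 / (t * delta ^+ d))%:E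
    + (varc tau2 / (t * delta ^+ d))%:E))%E).
    by rewrite lee_wpmul2l ?lee_fin //; exact: leeD.
  by rewrite -EFinD -EFinM lee_fin -mulrDl mulrA.
Qed.

End FixedIntensity.

Unset Implicit Arguments.

Theorem theorem9p1 (R : realType) (d : nat) (W : set (d.-tuple R))
  (dO : measure_display) (O : measurableType dO) (P : probability O R)
  (eta : R -> O -> seq (d.-tuple R)) (delta : R -> R) (tau1 tau2 : R) :
  (1 <= d)%N ->
  convex_set_d W -> compact_set_d W ->
  (forall t, 0 < t -> is_poisson_pp P (eta t) (intensity W t)) ->
  (forall t, 0 < t -> 0 < delta t) ->
  delta t @[t --> +oo] --> 0 ->
  t * delta t ^+ d @[t --> +oo] --> +oo ->
  - (d%:R / 2) < tau1 -> - (d%:R / 2) < tau2 ->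
  forall eps : R, 0 < eps ->
    P [set w | eps < `| (tau1 + d%:R) * Ltilde P (eta t) t (delta t) tau1 w
                        - (tau2 + d%:R) * Ltilde P (eta t) t (delta t) tau2 w |]
      @[t --> +oo] --> 0%E.
Proof.
move=> d0 _ cW HX delta0 cdelta cdense h1 h2 eps eps0.
have [V [mV finV ndV capV WV]] := compact_neighbourhoods cW.
have mW : measurable W by rewrite -capV; exact: bigcapT_measurable.
have finW : (lebm R d W < +oo)%E.
  apply: le_lt_trans finV; apply: le_measure; rewrite ?inE //.
  by rewrite -capV => x; exact.
(* Continuity from above: the sets [V n] minus W decrease to the empty set, inside [V 0] of finite
   measure. *)
have layer (r : R) : 0 < r -> exists n, (lebm R d (V n `\` W) <= r%:E)%E.
  move=> r0.
  have cF : (lebm R d \o (fun n => V n `\` W)) n @[n --> \oo]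
      --> lebm R d (\bigcap_n (V n `\` W)).
    apply: nonincreasing_cvg_mu.
    - apply: le_lt_trans finV; apply: le_measure; rewrite ?inE //.
      exact: measurableD.
    - by move=> n; exact: measurableD.
    - by apply: bigcapT_measurable => n; exact: measurableD.
    - move=> n m nm; apply/subsetPset; apply: setSD; exact/subsetPset/ndV.
  have cap0 : \bigcap_n (V n `\` W) = set0.
    rewrite -subset0 => x h; have [_ nWx] := h 0%N Logic.I; apply: nWx.
    by rewrite -capV => n _; case: (h n Logic.I).
  rewrite cap0 measure0 in cF.
  have /fine_cvgP[_ /cvgrPdist_le /(_ _ r0)] := cF.
  move=> /filter_ex[n /=]; rewrite sub0r normrN => hn; exists n.
  have fn : lebm R d (V n `\` W) \is a fin_num.
    rewrite ge0_fin_numE //; apply: le_lt_trans finV; apply: le_measure; rewrite ?inE //.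
      exact: measurableD.
    apply: subset_trans (@subDsetl _ _ _) _; exact/subsetPset/ndV.
  by rewrite -(fineK fn) lee_fin; apply: le_trans hn; exact: ler_norm.
set C := 2 * (varc W tau1 + varc W tau2).
set G := 2 * (kappa R d * d%:R) ^+ 2.
have G0 : 0 <= G by rewrite mulr_ge0 // sqr_ge0.
have e20 : 0 < eps ^+ 2 by rewrite exprn_gt0.
have bound (e : R) : 0 < e -> \forall t \near +oo,
    (P [set w | (eps < `| (tau1 + d%:R) * Ltilde P (eta t) t (delta t) tau1 w
                        - (tau2 + d%:R) * Ltilde P (eta t) t (delta t) tau2 w |)%R] <= e%:E)%E.
  (* Each of the two terms of [deviation_bound] is allowed half of eps^2 e. *)
  move=> e0; set h := eps ^+ 2 * e / 2.
  have hpos : 0 < h by rewrite divr_gt0 // mulr_gt0.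
  (* n depends on e alone and is fixed before t is taken large enough for [delta t] to be below
     1/(n+1). Dividing by G + 1 avoids a division by zero. *)
  have [n vn] : exists n, (lebm R d (V n `\` W) <= (h / (G + 1))%:E)%E.
    by apply: layer; rewrite divr_gt0 //; lra.
  near=> t.
  have t0 : 0 < t by near: t; exact: nbhs_pinfty_gt.
  have dt0 := delta0 _ t0.
  have dn : delta t < n.+1%:R^-1.
    apply: le_lt_trans (ler_norm _) _; near: t.
    have := cdelta; move=> /cvgr0Pnorm_lt; apply; by rewrite invr_gt0.
  (* Asking for |C| + 1 avoids any discussion of the sign of C. *)
  have big : (`|C| + 1) / h <= t * delta t ^+ d.
    by near: t; move/cvgryPge: cdense; apply.
  have tE0 : 0 < t * delta t ^+ d by rewrite mulr_gt0 // exprn_gt0.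
  have WVt x y : W x -> Defs.edist x y <= delta t -> V n y.
    by move=> Wx xy; apply: (WV n x y Wx); exact: le_lt_trans xy dn.
  have := deviation_bound d0 mW (mV n) finW t0 dt0 WVt (HX _ t0) h1 h2 eps0.
  set S := [set w | _] => main.
  have {}main : ((eps ^+ 2)%:E * P S <= (eps ^+ 2 * e)%:E)%E.
    apply: le_trans main _; rewrite -/C -/G.
    apply: (@le_trans _ _ (h%:E + h%:E)%E); last by rewrite -EFinD lee_fin /h; lra.
    apply: leeD.
      apply: (@le_trans _ _ (G%:E * (h / (G + 1))%:E)%E).
        by rewrite lee_wpmul2l // lee_fin.
      rewrite -EFinM lee_fin mulrCA ger_pMr // ler_pdivrMr; lra.
    rewrite lee_fin ler_pdivrMr //.
    move: big; rewrite ler_pdivrMr // mulrC => big.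
    by have := ler_norm C; lra.
  by move: main; rewrite (EFinM (eps ^+ 2) e) lee_pmul2l // lte_fin.
apply/fine_cvgP; split.
  have := bound 1 ltr01; apply: filterS => t ht.
  by rewrite ge0_fin_numE //; apply: le_lt_trans ht (ltry _).
apply/cvgr0Pnorm_le => e e0; have := bound e e0; apply: filterS => t ht /=.
rewrite ger0_norm ?fine_ge0 // -lee_fin fineK //.
by rewrite ge0_fin_numE //; apply: le_lt_trans ht (ltry _).
Unshelve. all: by end_near.
Qed.
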